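(* Let $L_\infty=\{R_n\}_{n\in\mathbb{N}}$ be the relational language containing an $n$-ary relation symbol $R_n$ for each $n\in\mathbb{N}$. Then the space $X_{L_\infty}$ of countably infinite structures for $L_\infty$, with the logic action of $S_\infty$, is a universal Borel $S_\infty$-space. In particular, the Vaught Conjecture for $L_{\omega_1\omega}$ is equivalent to the Topological Vaught Conjecture for $S_\infty$ (in any of its forms $\mathrm{TVC}_{I}(S_\infty)$, $\mathrm{TVC}_{II}(S_\infty)$, $\mathrm{TVC}_{III}(S_\infty)$).
   Context: A Polish space (group) is a separable, completely metrizable topological space (group). A standard Borel space is a Polish space with its associated Borel structure. For a Polish group $G$, a Borel $G$-space is a standard Borel space $X$ with an action $G\times X\to X$ of $G$ that is a Borel map; a Polish $G$-space is a Polish space $X$ with an action $G\times X\to X$ that is continuous. A Borel embedding of a Borel $G$-space $X$ into a Borel $G$-space $Y$ is a Borel injection $\pi:X\to Y$ with $\pi(g\cdot x)=g\cdot\pi(x)$ for all $g\in G,x\in X$. A Borel $G$-space $\mathcal U$ is universal if every Borel $G$-space has a Borel embedding into $\mathcal U$. $S_\infty$ is the group of all permutations of $\mathbb{N}$, with the Polish topology it inherits as a $G_\delta$ subspace of the Baire space $\mathbb{N}^{\mathbb{N}}$. Logic action: for a countable relational language $L=\{R_i\}_{i\in I}$ ($I$ countable, $R_i$ an $n_i$-ary relation symbol), let $X_L=\prod_{i\in I}2^{\mathbb{N}^{n_i}}$ with the product topology, where $2=\{0,1\}$. A point $x=(x_i)_{i\in I}\in X_L$ is identified with the structure $\mathcal{A}=\langle\mathbb{N},R_i^{\mathcal{A}}\rangle_{i\in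 I}$ where $R_i^{\mathcal{A}}(s)\Leftrightarrow x_i(s)=1$. The group $S_\infty$ acts on $X_L$ by $(g\cdot x)_i(s_0,\dots,s_{n_i-1})=x_i(g^{-1}(s_0),\dots,g^{-1}(s_{n_i-1}))$; thus $g\cdot x=y$ iff $g$ is an isomorphism from the structure coded by $x$ to the one coded by $y$. This is called the logic action. For $L=L_\infty$, $X_{L_\infty}$ is the space of all maps $\mathbb{N}^{<\mathbb{N}}\to\{0,1\}$ on finite sequences of natural numbers. The Vaught Conjecture for $L_{\omega_1\omega}$ is the assertion that every $L_{\omega_1\omega}$ sentence in a countable language has either countably many or else perfectly many countable models, up to isomorphism. The Borel invariant subsets of $X_L$ being exactly the sets of models of $L_{\omega_1\omega}$ sentences, this is the assertion that for any countable relational language $L$ and any Borel set $B\subseteq X_L$ invariant under the logic action, either $B$ contains countably many orbits or else there is a perfect set $P\subseteq B$ no two distinct members of which are in the same orbit. The Topological Vaught Conjecture for a Polish group $G$ has the following forms. $\mathrm{TVC}_{I}(G)$: for any Polish $G$-space $X$ and any invariant Borel set $B\subseteq X$, either $B$ contains countably many orbits or else there is a perfect set $P\subseteq B$ with any two distinct members of $P$ belonging to different orbits. $\mathrm{TVC}_{II}(G)$: the same as $\mathrm{TVC}_{I}(G)$ but only with $B=X$. $\mathrm{TVC}_{III}(G)$: for any Borel $G$-space $X$, either $X$ contains countably many orbits or else there is an uncountable Borel set $P\subseteq X$ with any two distinct members of $P$ belonging to different orbits. A perfect set is a nonempty closed set without isolated points; ''countably many'' includes finitely many. *)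

(* Defs.v *)
From HB Require Import structures.
From mathcomp Require Import all_boot all_order all_algebra.
From mathcomp Require Import all_classical all_reals all_analysis.

Set Implicit Arguments.
Unset Strict Implicit.
Unset Printing Implicit Defensive.

Import Order.TTheory GRing.Theory Num.Theory.
Local Open Scope classical_set_scope.
Local Open Scope ring_scope.

Definition separable (T : topologicalType) : Prop :=
  exists2 D : set T, countable D & dense D.

Definition completely_metrizable (R : realType) (T : topologicalType) : Prop :=
  exists d : T -> T -> R,
    [/\ forall x y, d x y = 0 <-> x = y,
        forall x y, d x y = d y x,
        forall x y z, d x z <= d x y + d y z,
        forall x, nbhs x =
          filter_from [set e : R | 0 < e] (fun e => [set y | d x y < e]) &
        forall u : nat -> T,
          (forall e : R, 0 < e -> exists N, forall m n,
             (N <= m)%N -> (N <= n)%N -> d (u m) (u n) < e) ->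
          exists x : T, u @ \oo --> x].

Definition polish (R : realType) (T : topologicalType) : Prop :=
  separable T /\ completely_metrizable R T.

Definition borel (T : topologicalType) : set (set T) := <<s @open T >>.

Definition borel_map (S T : topologicalType) (f : S -> T) : Prop :=
  forall B : set T, borel B -> borel (f @^-1` B).

HB.mixin Record isTopologicalGroup G of Group G & Topological G := {
  mulg_continuous : continuous (fun p : G * G => (p.1 * p.2)%g);
  invg_continuous : continuous (fun x : G => (x^-1)%g)
}.

#[short(type="topGroupType")]
HB.structure Definition TopologicalGroup :=
  {G of isTopologicalGroup G & Group G & Topological G}.

Definition is_action (G : groupType) (X : Type) (a : G -> X -> X) : Prop :=
  (forall x, a 1%g x = x) /\ (forall g h x, a (g * h)%g x = a g (a h x)).

(* A standard Borel space is presented by a Polish topology generating its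
   Borel structure; only the Borel sets of X are used below.  For separable
   metrizable G and X the Borel sets of the product topology on G * X are those
   of the product Borel structure. *)
Definition borel_space (R : realType) (G : topGroupType) (X : topologicalType)
    (a : G -> X -> X) : Prop :=
  [/\ polish R X, is_action a & borel_map (fun p : G * X => a p.1 p.2)].

Definition polish_space (R : realType) (G : topGroupType) (X : topologicalType)
    (a : G -> X -> X) : Prop :=
  [/\ polish R X, is_action a & continuous (fun p : G * X => a p.1 p.2)].

Definition borel_embedding (G : topGroupType) (X Y : topologicalType)
    (a : G -> X -> X) (b : G -> Y -> Y) (f : X -> Y) : Prop :=
  [/\ borel_map f, injective f & forall g x, f (a g x) = b g (f x)].

Definition universal_borel_space (R : realType) (G : topGroupType)
    (U : topologicalType) (b : G -> U -> U) : Prop :=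
  borel_space R b /\
  forall (X : topologicalType) (a : G -> X -> X), borel_space R a ->
    exists f : X -> U, borel_embedding a b f.

Definition same_orbit (G : groupType) (X : Type) (a : G -> X -> X) (x y : X) :
  Prop := exists g, a g x = y.

Definition invariant (G : groupType) (X : Type) (a : G -> X -> X) (B : set X) :
  Prop := forall g x, B x -> B (a g x).

Definition countably_many (X : Type) (E : X -> X -> Prop) (B : set X) : Prop :=
  countable [set [set y | E x y] | x in B].

Definition pairwise_inequivalent (X : Type) (E : X -> X -> Prop) (P : set X) :
  Prop := forall x y, P x -> P y -> x <> y -> ~ E x y.

(* [perfect_set] allows the empty set. *)
Definition perfectly_many (X : topologicalType) (E : X -> X -> Prop)
    (B : set X) : Prop :=
  exists P : set X,
    [/\ P !=set0, perfect_set P, P `<=` B & pairwise_inequivalent E P].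

Definition TVC_I (R : realType) (G : topGroupType) : Prop :=
  forall (X : topologicalType) (a : G -> X -> X), polish_space R a ->
  forall B : set X, borel B -> invariant a B ->
    countably_many (same_orbit a) B \/ perfectly_many (same_orbit a) B.

Definition TVC_II (R : realType) (G : topGroupType) : Prop :=
  forall (X : topologicalType) (a : G -> X -> X), polish_space R a ->
    countably_many (same_orbit a) [set: X] \/
    perfectly_many (same_orbit a) [set: X].

Definition TVC_III (R : realType) (G : topGroupType) : Prop :=
  forall (X : topologicalType) (a : G -> X -> X), borel_space R a ->
    countably_many (same_orbit a) [set: X] \/
    exists P : set X,
      [/\ borel P, ~ countable P & pairwise_inequivalent (same_orbit a) P].

Definition Sinf : Type := set_type [set f : {ptws nat -> nat} | bijective f].

HB.instance Definition _ := Topological.on Sinf.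

Definition Sinf_fun (g : Sinf) : nat -> nat := set_val g.
Coercion Sinf_fun : Sinf >-> Funclass.

Section SinfGroup.

Lemma Sinf_bij (g : Sinf) : bijective g.
Proof. exact: (set_mem (valP g)). Qed.

Definition mkSinf (f : nat -> nat) (fbij : bijective f) : Sinf :=
  exist _ (f : {ptws nat -> nat}) (mem_set fbij).

Lemma Sinf_eqP (g h : Sinf) : g =1 h -> g = h.
Proof. by move=> gh; apply: val_inj; apply/funext => n; exact: gh. Qed.

Lemma Sinf_inv_subproof (g : Sinf) :
  exists h : nat -> nat, cancel g h /\ cancel h g.
Proof. by have [h gh hg] := Sinf_bij g; exists h. Qed.

Definition Sinf_inv_fun (g : Sinf) : nat -> nat :=
  projT1 (cid (Sinf_inv_subproof g)).

Lemma Sinf_funK (g : Sinf) : cancel g (Sinf_inv_fun g).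
Proof. by rewrite /Sinf_inv_fun; case: cid => h []. Qed.

Lemma Sinf_inv_funK (g : Sinf) : cancel (Sinf_inv_fun g) g.
Proof. by rewrite /Sinf_inv_fun; case: cid => h []. Qed.

Definition Sinf_one : Sinf :=
  mkSinf (@Bijective nat nat idfun idfun (fun=> erefl) (fun=> erefl)).

Definition Sinf_mul (g h : Sinf) : Sinf :=
  mkSinf (bij_comp (Sinf_bij g) (Sinf_bij h)).

Definition Sinf_inv (g : Sinf) : Sinf :=
  mkSinf (Bijective (Sinf_inv_funK g) (Sinf_funK g)).

Lemma Sinf_mulA : associative Sinf_mul.
Proof. by move=> f g h; apply: Sinf_eqP. Qed.

Lemma Sinf_mul1 : left_id Sinf_one Sinf_mul.
Proof. by move=> g; apply: Sinf_eqP. Qed.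

Lemma Sinf_1mul : right_id Sinf_one Sinf_mul.
Proof. by move=> g; apply: Sinf_eqP. Qed.

Lemma Sinf_mulV : left_inverse Sinf_one Sinf_inv Sinf_mul.
Proof. by move=> g; apply: Sinf_eqP => n; exact: Sinf_funK. Qed.

Lemma Sinf_Vmul : right_inverse Sinf_one Sinf_inv Sinf_mul.
Proof. by move=> g; apply: Sinf_eqP => n; exact: Sinf_inv_funK. Qed.

End SinfGroup.

HB.instance Definition _ := isGroup.Build Sinf
  Sinf_mulA Sinf_mul1 Sinf_1mul Sinf_mulV Sinf_Vmul.

Lemma nbhs_Sinf (g : Sinf) (n : nat) : nbhs g [set h : Sinf | h n = g n].
Proof.
have cv : continuous (fun h : Sinf => h n).
  move=> h; apply: (@continuous_comp Sinf {ptws nat -> nat} nat set_val (@^~ n)).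
    exact: initial_continuous.
  exact: (@proj_continuous nat (fun=> nat) n).
by apply: (cv g [set g n]); rewrite nbhs_principalE; exact/principal_filterP.
Qed.

Lemma cvg_Sinf (F : set_system Sinf) (g : Sinf) : Filter F ->
  (forall n, F [set h : Sinf | h n = g n]) -> F --> g.
Proof.
move=> FF Fg A [_ [[B oB <-] Bg] BA].
have {}Fg : set_val @ F --> (set_val g : {ptws nat -> nat}).
  apply/cvg_sup => n C [_ [[D oD <-] Dg] DC].
  apply: (@filterS Sinf F _ [set h | h n = g n]) (Fg n) => h hg /=.
  by apply: DC; rewrite /= -[set_val h n]/(h n) hg.
apply: (filterS BA); apply: Fg; exact: open_nbhs_nbhs.
Qed.

Lemma Sinf_mulg_continuous :
  continuous (fun p : Sinf * Sinf => (p.1 * p.2)%g).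
Proof.
case=> g0 h0; pose g : Sinf := g0; pose h : Sinf := h0.
apply: (@cvg_Sinf _ (g * h)%g) => n.
exists ([set x : Sinf | x (h n) = g (h n)], [set y : Sinf | y n = h n]) => /=.
  by split; exact: nbhs_Sinf.
by move=> [x y] /= [xE yE]; rewrite -[LHS]/(x (y n)) yE.
Qed.

Lemma Sinf_invg_continuous : continuous (fun g : Sinf => (g^-1)%g).
Proof.
move=> g0; pose g : Sinf := g0.
apply: (@cvg_Sinf _ (g^-1)%g (fmap_filter _ (nbhs_filter g))) => n.
apply: filterS (nbhs_Sinf g (Sinf_inv_fun g n)) => h /= hE.
by rewrite -[LHS]/(Sinf_inv_fun h n) -[RHS]/(Sinf_inv_fun g n)
  -[in LHS](Sinf_inv_funK g n) -hE Sinf_funK.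
Qed.

HB.instance Definition _ :=
  isTopologicalGroup.Build Sinf Sinf_mulg_continuous Sinf_invg_continuous.

Record language := Language { symbol : countType; arity : symbol -> nat }.

(* A structure with universe [nat]; the outer and inner products carry the
   product topology and [bool] is discrete. *)
Definition structure (L : language) : Type :=
  prod_topology (fun i : symbol L => {ptws (arity i).-tuple nat -> bool}).

HB.instance Definition _ (L : language) := Topological.on (structure L).

Definition logic_action (L : language) (g : Sinf) (x : structure L) :
  structure L := fun i s => x i (map_tuple (g^-1%g : Sinf) s).

Definition isomorphic (L : language) (x y : structure L) : Prop :=
  exists2 f : nat -> nat, bijective f &
    forall (i : symbol L) (s : (arity i).-tuple nat),
      y i (map_tuple f s) = x i s.

Definition L_infty : language := @Language nat id.

(* [formula L n] has its free variables among the [n] variables ['I_n]; under a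
   quantifier the bound variable is [ord0] and the others are shifted by one.
   [And] and [Or] are the countable conjunction and disjunction; finite nonempty
   ones arise by repeating formulas. *)
Inductive formula (L : language) : nat -> Type :=
| Equal n : 'I_n -> 'I_n -> formula L n
| Rel n (i : symbol L) : (arity i).-tuple 'I_n -> formula L n
| Not n : formula L n -> formula L n
| And n : (nat -> formula L n) -> formula L n
| Or n : (nat -> formula L n) -> formula L n
| Forall n : formula L n.+1 -> formula L n
| Exists n : formula L n.+1 -> formula L n.

Definition sentence (L : language) : Type := formula L 0.

Fixpoint sat (L : language) (x : structure L) (n : nat) (phi : formula L n) :
    n.-tuple nat -> Prop :=
  match phi in formula _ n return n.-tuple nat -> Prop with
  | Equal _ j k => fun v => tnth v j = tnth v k
  | Rel _ i t => fun v => x i (map_tuple (tnth v) t)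
  | Not _ phi => fun v => ~ sat x phi v
  | And _ phi => fun v => forall k, sat x (phi k) v
  | Or _ phi => fun v => exists k, sat x (phi k) v
  | Forall _ phi => fun v => forall a : nat, sat x phi [tuple of a :: v]
  | Exists _ phi => fun v => exists a : nat, sat x phi [tuple of a :: v]
  end.

Definition models (L : language) (phi : sentence L) : set (structure L) :=
  [set x | sat x phi [tuple]].

Definition vaught_conjecture : Prop :=
  forall (L : language) (phi : sentence L),
    countably_many (@isomorphic L) (models phi) \/
    perfectly_many (@isomorphic L) (models phi).

(* Main.v *)
(* For [s : seq nat] let U_s be the set of the permutations [g] with [g s_i = i]
   for all [i].  Given a Borel action of [Sinf] on a Polish space with basis (A_k),
   code a point [x] by the structure whose relations hold at [s] when
   {g in U_s : g x in A_k} is not meager, each [k] serving infinitely many arities.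
   Right translation makes the coding equivariant.  From the code of [x] and a
   generic [g] one recovers the sets A_k containing [g x], hence [g x] itself:
   this gives injectivity, and it shows that the image of an invariant Borel set is
   Borel, since the category quantifier preserves Borel sets.  By the Vaught
   transform an invariant Borel set of structures is the set of models of a
   sentence, so the Vaught conjecture applies to the image and yields a perfect
   set of inequivalent codes, whose preimage is an uncountable Borel set and so
   contains a perfect set.  Conversely the models of a sentence form a Polish
   [Sinf]-space for the topology generated by the truth values of its
   subformulas, with the same Borel sets. *)

From HB Require Import structures.
Require Import Defs.
From mathcomp Require Import all_boot all_order all_algebra.
From mathcomp Require Import all_classical all_reals all_analysis.
From mathcomp Require Import lra.

Set Implicit Arguments.
Unset Strict Implicit.
Unset Printing Implicit Defensive.

Import Order.TTheory GRing.Theory Num.Theory.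
Local Open Scope classical_set_scope.
Local Open Scope ring_scope.

(** * Borel sets and complete metrics *)

(** [L_infty] has one relation in each arity, so at a sequence of given length only one A_k can be
    tested. This suffices because non-meagerness in U_w passes to U_s for every prefix s of w: by
    the Baire property, {g : g x in A_k} is comeager in U_t once it is non-meager in U_w for all
    extensions w of t whose length serves k, and such lengths must therefore be unbounded. The
    condition g s_i = i makes s an initial segment of the inverse of g. The logic action also reads
    the inverse of g, so a sequence is at once a condition on g for category arguments and an
    assignment of values to the variables of a formula. Non-meagerness is preferred to comeagerness
    because it commutes with countable unions, while a complement costs one quantifier over the
    extensions of s; this one computation gives both the Borel and the definable version of the
    category quantifier. *)

Lemma borel_ind (T : topologicalType) (P : set (set T)) :
  (forall A, open A -> P A) -> (forall A, P A -> P (~` A)) ->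
  (forall F : nat -> set T, (forall n, P (F n)) -> P (\bigcup_n F n)) ->
  forall A, borel A -> P A.
Proof.
move=> Po PC PU; apply: smallest_sub; last by move=> A; exact: Po.
split=> //; first by apply: Po; exact: open0.
by move=> A PA; rewrite setTD; exact: PC.
Qed.

Section BorelTheory.
Variable T : topologicalType.
Implicit Types (A B : set T) (P Q : T -> Prop).

Lemma borel_open A : open A -> borel A.
Proof. exact: sub_sigma_algebra. Qed.

Lemma borel_setC A : borel A -> borel (~` A).
Proof. by move=> bA; rewrite -setTD; exact: sigma_algebraCD. Qed.

Lemma borel_not P : borel [set x | P x] -> borel [set x | ~ P x].
Proof. exact: borel_setC. Qed.

Lemma borel_closed A : closed A -> borel A.
Proof.
by move=> cA; rewrite -[A]setCK; apply: borel_setC; apply: borel_open; rewrite openC.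
Qed.

Lemma borel_const (Q : Prop) : borel [set x : T | Q].
Proof.
case: (pselect Q) => q; apply: borel_open.
  by rewrite (_ : [set _ | _] = setT) ?predeqE //; exact: openT.
by rewrite (_ : [set _ | _] = set0) ?predeqE //; exact: open0.
Qed.

Lemma borel_bigcup (F : nat -> set T) :
  (forall n, borel (F n)) -> borel (\bigcup_n F n).
Proof. exact: sigma_algebra_bigcup. Qed.

Lemma borel_exists (I : countType) (P : I -> T -> Prop) :
  (forall i, borel [set x | P i x]) -> borel [set x | exists i, P i x].
Proof.
move=> bP.
rewrite (_ : [set x | _] = \bigcup_n
  (if unpickle n is Some i then [set x | P i x] else set0)).
  apply: borel_bigcup => n; case: unpickle => [i|]; first exact: bP.
  exact: borel_open open0.
apply/seteqP; split=> x /= [i].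
  by exists (pickle i) => //; rewrite pickleK.
by move=> _; case: unpickle => // j ?; exists j.
Qed.

Lemma borel_forall (I : countType) (P : I -> T -> Prop) :
  (forall i, borel [set x | P i x]) -> borel [set x | forall i, P i x].
Proof.
move=> bP.
rewrite (_ : [set x | _] = ~` [set x | exists i, ~ P i x]).
  by apply: borel_setC; apply: borel_exists => i; exact: borel_not.
by apply/seteqP; split=> x /= => [Px [i]//|/forallNP Px i]; exact: contrapT.
Qed.

Lemma borel_and P Q : borel [set x | P x] -> borel [set x | Q x] ->
  borel [set x | P x /\ Q x].
Proof.
move=> bP bQ.
rewrite (_ : [set x | _] = [set x | forall b : bool, (if b then P else Q) x]).
  by apply: borel_forall => -[].
apply/seteqP; split=> x /= => [[? ?] []//|PQ].
by split; [exact: (PQ true)|exact: (PQ false)].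
Qed.

Lemma borel_imply P Q : borel [set x | P x] -> borel [set x | Q x] ->
  borel [set x | P x -> Q x].
Proof.
move=> bP bQ.
rewrite (_ : [set x | _] = [set x | ~ (P x /\ ~ Q x)]).
  by apply: borel_not; apply: borel_and => //; exact: borel_not.
apply/seteqP; split=> x /= => [PQ [p]|PQ p]; first by apply; exact: PQ.
by apply: contrapT => q; apply: PQ.
Qed.

Lemma borel_iff P Q : borel [set x | P x] -> borel [set x | Q x] ->
  borel [set x | P x <-> Q x].
Proof. by move=> bP bQ; apply: borel_and; exact: borel_imply. Qed.

Lemma borel_or P Q : borel [set x | P x] -> borel [set x | Q x] ->
  borel [set x | P x \/ Q x].
Proof.
move=> bP bQ.
rewrite (_ : [set x | _] = [set x | exists b : bool, (if b then P else Q) x]).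
  by apply: borel_exists => -[].
apply/seteqP; split=> x /=; first by case=> ?; [exists true|exists false].
by case=> -[]; [left|right].
Qed.

End BorelTheory.

Lemma open_borel_map (S T : topologicalType) (f : S -> T) :
  (forall U, open U -> borel (f @^-1` U)) -> borel_map f.
Proof.
move=> fo; apply: borel_ind => //.
- by move=> A; rewrite -preimage_setC; exact: borel_setC.
- by move=> F bF; rewrite preimage_bigcup; exact: borel_bigcup.
Qed.

Lemma continuous_borel_map (S T : topologicalType) (f : S -> T) :
  continuous f -> borel_map f.
Proof.
by move=> /continuousP fc; apply: open_borel_map => U /fc; exact: borel_open.
Qed.

Record complete_metric (R : realType) (T : topologicalType) (d : T -> T -> R) :
    Prop := CompleteMetric {
  dist_eq0 : forall x y, d x y = 0 <-> x = y;
  distC : forall x y, d x y = d y x;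
  dist_tri : forall x y z, d x z <= d x y + d y z;
  nbhs_dist : forall x, nbhs x =
    filter_from [set e : R | 0 < e] (fun e => [set y | d x y < e]);
  dist_complete : forall u : nat -> T,
    (forall e : R, 0 < e -> exists N, forall m n,
       (N <= m)%N -> (N <= n)%N -> d (u m) (u n) < e) ->
    exists x : T, u @ \oo --> x
}.

Lemma completely_metrizableP (R : realType) (T : topologicalType) :
  completely_metrizable R T <-> exists d : T -> T -> R, complete_metric d.
Proof. by split=> -[d [*]]; exists d. Qed.

Section MetricTheory.
Variables (R : realType) (T : topologicalType) (d : T -> T -> R).
Hypothesis dP : complete_metric d.

Lemma distxx x : d x x = 0. Proof. exact/(dist_eq0 dP). Qed.

Lemma dist_ge0 x y : 0 <= d x y.
Proof.
have := dist_tri dP x y x; rewrite distxx (distC dP y x) -mulr2n.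
by rewrite pmulrn_lge0.
Qed.

Lemma dist_gt0 x y : x <> y -> 0 < d x y.
Proof.
move=> xy; rewrite lt_neqAle dist_ge0 andbT eq_sym.
by apply/eqP => /(dist_eq0 dP).
Qed.

Lemma nbhs_ballP x A :
  nbhs x A <-> exists2 e, 0 < e & forall y, d x y < e -> A y.
Proof. by rewrite (nbhs_dist dP); split=> -[e]; exists e. Qed.

Lemma nbhs_dball x e : 0 < e -> nbhs x [set y | d x y < e].
Proof. by move=> e0; apply/nbhs_ballP; exists e. Qed.

Lemma open_dball x e : open [set y | d x y < e].
Proof.
rewrite openE => y /= xye; apply/nbhs_ballP.
exists (e - d x y); first by rewrite subr_gt0.
move=> z yz; apply: le_lt_trans (dist_tri dP x y z) _.
by rewrite -ltrBrDl.
Qed.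

Lemma invS_small (e : R) : 0 < e -> exists n, n.+1%:R^-1 < e.
Proof.
move=> e0; have [n] := ltr_add_invr e0; rewrite add0r => ?.
by exists n.
Qed.

Lemma cvg_distP (u : nat -> T) (x : T) : (u @ \oo --> x) <->
  forall e, 0 < e -> exists N, forall n, (N <= n)%N -> d (u n) x < e.
Proof.
split=> [ux e e0|ux A].
  have [N _ Nu] := ux _ (nbhs_dball x e0).
  by exists N => n Nn; rewrite (distC dP); exact: Nu.
case/nbhs_ballP=> e e0 eA; have [N Nu] := ux _ e0.
by exists N => // n /= Nn; apply: eA; rewrite (distC dP); exact: Nu.
Qed.

Lemma cvg_dist_unique (u : nat -> T) (x y : T) :
  u @ \oo --> x -> u @ \oo --> y -> x = y.
Proof.
move=> /cvg_distP ux /cvg_distP uy; apply: contrapT => /dist_gt0 xy.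
have xy2 : 0 < d x y / 2 by rewrite divr_gt0.
have [N1 H1] := ux _ xy2; have [N2 H2] := uy _ xy2.
have := dist_tri dP x (u (maxn N1 N2)) y.
rewrite leNgt => /negP; apply; rewrite [ltRHS]splitr ltrD //.
  by rewrite (distC dP); apply: H1; rewrite leq_maxl.
by apply: H2; rewrite leq_maxr.
Qed.

End MetricTheory.

Lemma separable_seq (T : topologicalType) (x0 : T) : separable T ->
  exists D : nat -> T, forall A, open A -> A !=set0 -> exists n, A (D n).
Proof.
case=> D /countable_injP[f finj] dD.
pose D' n : T :=
  if pselect (exists2 x, D x & f x = n) is left h then projT1 (cid2 h) else x0.
exists D' => A oA A0; have [x [Ax Dx]] := dD A A0 oA.
exists (f x); rewrite /D'; case: pselect => [h|[]]; last by exists x.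
by case: cid2 => /= y Dy /finj -> //; rewrite inE.
Qed.

(** * Polish spaces given by codes *)

(** Merges supports: finitely many conditions, each decided by finitely many coordinates, are
    decided by one finite list of coordinates. *)
Lemma seq_choice (I : eqType) (J : Type) (P : I -> seq J -> Prop) (F : seq I) :
  (forall i G H, P i G -> P i (G ++ H)) ->
  (forall i G H, P i H -> P i (G ++ H)) ->
  (forall i, exists G, P i G) -> exists G, {in F, forall i, P i G}.
Proof.
move=> Pl Pr Pex; elim: F => [|i F [G GP]]; first by exists nil.
have [H HP] := Pex i; exists (H ++ G) => j; rewrite inE => /predU1P[->|jF].
  exact: Pl.
by apply: Pr; exact: GP.
Qed.

Section PolishOfCodes.
Variables (R : realType) (T : topologicalType) (J : countType).
Variable c : T -> J -> nat.
Hypothesis nbhs_code : forall x A,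
  nbhs x A <-> exists F : seq J, forall y, {in F, c y =1 c x} -> A y.
Hypothesis code_inj : forall x y, c x =1 c y -> x = y.
Hypothesis code_closed : forall b : J -> nat,
  (forall F : seq J, exists x, {in F, c x =1 b}) -> exists x, c x =1 b.

Let agree n x y := forall j, (pickle j < n)%N -> c x j = c y j.

Let agree_sym n x y : agree n x y -> agree n y x.
Proof. by move=> xy j /xy. Qed.

Let agree_trans n x y z : agree n x y -> agree n y z -> agree n x z.
Proof. by move=> xy yz j jn; rewrite xy // yz. Qed.

Let agree_le m n x y : (m <= n)%N -> agree n x y -> agree m x y.
Proof. by move=> mn xy j jm; apply: xy; exact: leq_trans mn. Qed.

Let agreeP x y : (forall n, agree n x y) <-> x = y.
Proof.
by split=> [xy|-> //]; apply: code_inj => j; exact: (xy (pickle j).+1).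
Qed.

Let seq_bound (F : seq J) : exists n, {in F, forall j, (pickle j < n)%N}.
Proof.
exists (\max_(j <- F) (pickle j).+1)%N => j jF.
exact: (@leq_bigmax_seq _ F xpredT (fun j => (pickle j).+1)).
Qed.

(** The inverse of the least n at which agreement fails. As [agree 0] always holds, this n is
    positive, so the value 0 is left to equal points. *)
Let dist x y : R :=
  if pselect (exists n, `[< ~ agree n x y >]) is left h
  then (ex_minn h)%:R^-1 else 0.

Let distP x y : (x = y /\ dist x y = 0) \/
  exists n, [/\ ~ agree n.+1 x y, agree n x y & dist x y = n.+1%:R^-1].
Proof.
rewrite /dist; case: pselect => [h|nh].
  right; case: ex_minnP => -[/asboolP[] //|n /asboolP xy nmin].
  exists n; split=> //; apply: contrapT => nxy.
  by have := nmin n (asboolT nxy); rewrite ltnn.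
left; split=> //; apply/agreeP => n; apply: contrapT => nxy.
by apply: nh; exists n; exact/asboolP.
Qed.

Let dist_lt n x y : dist x y < n.+1%:R^-1 <-> agree n.+1 x y.
Proof.
case: (distP x y) => [[-> ->]|[m [nxy xy ->]]].
  by split=> // _; rewrite invr_gt0 ltr0n.
rewrite ltf_pV2 ?posrE ?ltr0n // ltr_nat ltnS; split=> [nm|nxy'].
  exact: agree_le xy.
by rewrite ltnNge; apply/negP => mn; apply: nxy; exact: agree_le nxy'.
Qed.

Let dist_ge n x y : ~ agree n.+1 x y -> n.+1%:R^-1 <= dist x y.
Proof. by move=> nxy; rewrite leNgt; apply/negP => /dist_lt. Qed.

Let dist_lt_ex (e : R) : 0 < e ->
  exists n, forall x y, agree n x y -> dist x y < e.
Proof.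
move=> /invS_small[n ne]; exists n.+1 => x y /dist_lt xy.
exact: lt_trans xy ne.
Qed.

Let dist_metric : complete_metric dist.
Proof.
have dist0 x : dist x x = 0.
  by case: (distP x x) => [[]//|[n [nx _ _]]]; case: nx.
have dist_pos x y : 0 <= dist x y.
  by case: (distP x y) => [[_ ->]//|[n [_ _ ->]]]; rewrite invr_ge0 ler0n.
split.
- move=> x y; split=> [|->//].
  by case: (distP x y) => [[]//|[n [_ _ ->]]] /eqP; rewrite invr_eq0 pnatr_eq0.
- move=> x y; wlog: x y / dist x y <= dist y x.
    by move=> H; case: (leP (dist x y) (dist y x)) => [/H //|/ltW /H].
  move=> le_xy; apply/eqP; rewrite eq_le le_xy /=.
  case: (distP x y) => [[-> _]|[n [nxy xy ->]]]; first exact: lexx.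
  case: (distP y x) => [[_ ->]|[m [nyx yx ->]]]; first by rewrite invr_ge0.
  rewrite lef_pV2 ?posrE ?ltr0n // ler_nat ltnNge; apply/negP => mn.
  by apply: nyx; apply: agree_le mn _; exact: agree_sym.
- move=> x y z; case: (distP x z) => [[_ ->]|[n [nxz _ ->]]].
    exact: addr_ge0.
  have [xy|/dist_ge xy] := pselect (agree n.+1 x y); last first.
    by rewrite -[leLHS]addr0 lerD.
  have [yz|/dist_ge yz] := pselect (agree n.+1 y z); last first.
    by rewrite -[leLHS]add0r lerD.
  by have := agree_trans xy yz.
- move=> x; apply/seteqP; split=> A.
    move=> /nbhs_code[F FA]; have [n nF] := seq_bound F.
    exists n.+1%:R^-1; first by rewrite /= invr_gt0 ltr0n.
    move=> y /= /dist_lt xy; apply: FA => j /nF jn.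
    by rewrite xy // ltnS ltnW.
  case=> e /= /dist_lt_ex[n ne] nA; apply/nbhs_code.
  exists (pmap unpickle (iota 0 n)) => y yx; apply: nA; apply: ne => j jn.
  rewrite yx // mem_pmap; apply/mapP; exists (pickle j); last by rewrite pickleK.
  by rewrite mem_iota.
- move=> u uC.
  have /choice[N NP] m : exists N, forall p q, (N <= p)%N -> (N <= q)%N ->
      agree m.+1 (u p) (u q).
    have [|N NP] := uC m.+1%:R^-1; first by rewrite invr_gt0 ltr0n.
    by exists N => p q Np Nq; apply/dist_lt/NP.
  (* The code of the limit is read off coordinatewise, at a stage [Nj j] after which coordinate j is
     constant. One late term of the sequence realizes finitely many coordinates at once, so
     [code_closed] applies. *)
  pose Nj (j : J) := N (pickle j).
  have NjP j n : (Nj j <= n)%N -> c (u n) j = c (u (Nj j)) j.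
    by move=> jn; apply: (NP (pickle j)).
  have Fle (F : seq J) n :
      (\max_(j <- F) Nj j <= n)%N -> {in F, forall j, (Nj j <= n)%N}.
    by move=> Fn j jF; apply: leq_trans Fn; exact: leq_bigmax_seq.
  have [|x xb] := @code_closed (fun j => c (u (Nj j)) j).
    move=> F; exists (u (\max_(j <- F) Nj j)%N) => j jF.
    by apply: NjP; exact: (Fle F).
  exists x => A /nbhs_code[F FA]; exists (\max_(j <- F) Nj j)%N => // n /= Fn.
  by apply: FA => j jF; rewrite xb; apply: NjP; exact: (Fle F).
Qed.

Lemma polish_of_codes : polish R T.
Proof.
split; last by apply/completely_metrizableP; exists dist; exact: dist_metric.
pose ok (q : seq (J * nat)) x := {in q, forall p, c x p.1 = p.2}.
(* One chosen point for each satisfiable finite condition on codes; there are countably many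
   conditions. *)
exists [set x | exists q, exists h : exists x, ok q x, x = projT1 (cid h)].
  pose f (q : seq (J * nat)) : option T :=
    if pselect (exists x, ok q x) is left h then Some (projT1 (cid h)) else None.
  have : countable [set f q | q in setT] by
    apply: (sub_countable (card_image_le _ _)).

  move=> /countable_injP[g ginj].
  have fh q (h : exists x, ok q x) : f q = Some (projT1 (cid h)).
    by rewrite /f; case: pselect => // h'; rewrite (Prop_irrelevance h h').
  apply/countable_injP; exists (g \o Some) => x y.
  rewrite !inE => -[q [h ->]] [q' [h' ->]] /=; rewrite -!fh => /ginj E.
  by apply: Some_inj; rewrite -!fh; apply: E; rewrite inE; [exists q|exists q'].
move=> A [x Ax] oA.
have /nbhs_code[F FA] : nbhs x A by exact: open_nbhs_nbhs.
have h : exists y, ok [seq (j, c x j) | j <- F] y.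
  by exists x => _ /mapP[j jF ->].
exists (projT1 (cid h)); split; last by exists [seq (j, c x j) | j <- F], h.
by case: cid => y /= yF; apply: FA => j jF; apply: (yF (j, c x j)); exact: map_f.
Qed.

End PolishOfCodes.

(** * G_delta conditions on sequences of bits *)

Section Pi02.
Variable I : countType.
Implicit Types (P : (I -> bool) -> Prop).

(** The clopen sets of the Cantor space; one implication is enough because agreement on F is
    symmetric. *)
Definition finsupp P := exists F : seq I,
  forall a b : I -> bool, {in F, a =1 b} -> P a -> P b.

Lemma finsupp_const (Q : Prop) : finsupp (fun=> Q).
Proof. by exists nil. Qed.

Lemma finsupp_bit i : finsupp (fun a => a i).
Proof. by exists [:: i] => a b ab; rewrite ab ?inE. Qed.

Lemma finsupp_imply P P' : finsupp P -> finsupp P' ->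
  finsupp (fun a => P a -> P' a).
Proof.
move=> [F FP] [F' FP']; exists (F ++ F') => a b ab aPP' /FP bP.
apply: (FP' a) => [i iF|]; first by rewrite ab // mem_cat iF orbT.
by apply: aPP'; apply: bP => i iF; rewrite ab // mem_cat iF.
Qed.

Lemma finsupp_and P P' : finsupp P -> finsupp P' ->
  finsupp (fun a => P a /\ P' a).
Proof.
move=> [F FP] [F' FP']; exists (F ++ F') => a b ab [aP aP']; split.
  by apply: FP aP => i iF; rewrite ab // mem_cat iF.
by apply: FP' aP' => i iF; rewrite ab // mem_cat iF orbT.
Qed.

Lemma finsupp_iff P P' : finsupp P -> finsupp P' ->
  finsupp (fun a => P a <-> P' a).
Proof. by move=> FP FP'; apply: finsupp_and; exact: finsupp_imply. Qed.

(** The G_delta sets of the Cantor space: each open set is a countable union of clopen ones. *)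
Definition pi02 P := exists O : nat -> nat -> (I -> bool) -> Prop,
  (forall m n, finsupp (O m n)) /\
  forall a, P a <-> forall m, exists n, O m n a.

Lemma pi02_exists (P : nat -> (I -> bool) -> Prop) :
  (forall n, finsupp (P n)) -> pi02 (fun a => exists n, P n a).
Proof.
by move=> PF; exists (fun=> P); split=> // a; split=> [aP //|]; apply; exact: 0%N.
Qed.

Lemma pi02_finsupp P : finsupp P -> pi02 P.
Proof.
move=> PF; exists (fun _ _ => P); split=> // a.
by split=> [|/(_ 0%N)[]//]; exists 0%N.
Qed.

Lemma pi02_forall (K : countType) (P : K -> (I -> bool) -> Prop) :
  (forall k, pi02 (P k)) -> pi02 (fun a => forall k, P k a).
Proof.
move=> /choice[W WP]; have [WF PW] := all_and2 WP.
exists (fun m n a => if unpickle m is Some (k, m') then W k m' n a else True).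
split=> [m n|a]; first by case: unpickle => [[k m']|]; [|exact: finsupp_const].
split=> [aP m|aW k].
  by case: unpickle => [[k m']|]; [apply: (PW k a).1|exists 0%N].
by apply/PW => m; have := aW (pickle (k, m)); rewrite pickleK.
Qed.

Lemma pi02_and P P' : pi02 P -> pi02 P' -> pi02 (fun a => P a /\ P' a).
Proof.
move=> FP FP'; have := @pi02_forall _ (fun b : bool => if b then P else P').
case=> [[]//|W [WF PW]]; exists W; split=> // a; rewrite -PW.
by split=> [[? ?] []//|PP']; split; [exact: (PP' true)|exact: (PP' false)].
Qed.

(** Classically, an implication from a universal statement is an existential one: some k satisfies
    [a (j k) -> a i]. The equivalence is thus a closed condition together with an open one. *)
Lemma pi02_iff_forall i (j : nat -> I) :
  pi02 (fun a => a i <-> forall k, a (j k)).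
Proof.
rewrite (_ : (fun a : I -> bool => _) = fun a : I -> bool =>
    (forall k, a i -> a (j k)) /\ exists k, a (j k) -> a i).
  apply: pi02_and.
    apply: pi02_forall => k; apply: pi02_finsupp.
    by apply: finsupp_imply; exact: finsupp_bit.
  by apply: pi02_exists => k; apply: finsupp_imply; exact: finsupp_bit.
apply/funext => a; apply/propext; split=> [[ij ji]|[ij [k kij]]].
  split=> [k /ij //|]; have [[k nk]|nk] := pselect (exists k, ~ a (j k)).
    by exists k.
  by exists 0%N => _; apply: ji => k; apply: contrapT => nak; apply: nk; exists k.
by split=> [ai m|aj]; [exact: ij|exact: kij].
Qed.

Lemma pi02_iff_exists i (j : nat -> I) :
  pi02 (fun a => a i <-> exists k, a (j k)).
Proof.
rewrite (_ : (fun a : I -> bool => _) = fun a : I -> bool =>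
    (forall k, a (j k) -> a i) /\ exists k, a i -> a (j k)).
  apply: pi02_and.
    apply: pi02_forall => k; apply: pi02_finsupp.
    by apply: finsupp_imply; exact: finsupp_bit.
  by apply: pi02_exists => k; apply: finsupp_imply; exact: finsupp_bit.
apply/funext => a; apply/propext; split=> [[ij ji]|[ji [k kij]]].
  split=> [k ajk|]; first by apply: ji; exists k.
  have [ai|nai] := pselect (a i); last by exists 0%N.
  by have [k ajk] := ij ai; exists k.
by split=> [/kij|[m /ji //]]; exists k.
Qed.

End Pi02.

(** * Topologies given by countably many bits *)

Section Bits.
Variables (R : realType) (T : topologicalType) (I : countType).
Variable c : T -> I -> bool.

Definition bit_topology := forall x A,
  nbhs x A <-> exists F : seq I, forall y, {in F, c y =1 c x} -> A y.

Hypothesis cT : bit_topology.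

(* Recording for each [m] the least witness of the condition [m] turns a Pi02 set
   of bits into a closed set of codes, without changing the topology. *)
Lemma polish_of_bits (P : (I -> bool) -> Prop) :
  (forall x y, c x =1 c y -> x = y) -> pi02 P -> (forall x, P (c x)) ->
  (forall a, P a -> exists x, c x =1 a) -> polish R T.
Proof.
move=> cinj [W [WF PW]] cP Pc.
pose least m x := ex_minn (let: ex_intro n h := (PW (c x)).1 (cP x) m in
  ex_intro (fun n => `[< W m n (c x) >]) n (asboolT h)).
have leastP m x n : least m x = n <->
    W m n (c x) /\ forall k, (k < n)%N -> ~ W m k (c x).
  rewrite /least; case: ex_minnP => l /asboolP Ol lmin; split=> [<-|[On nmin]].
    by split=> // k kl /asboolT /lmin; rewrite leqNgt kl.
  apply/eqP; rewrite eqn_leq (lmin n (asboolT On)) /= leqNgt.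
  by apply/negP => /nmin.
pose code x (j : I + nat) : nat :=
  match j with inl i => c x i | inr m => least m x end.
(* [least m x = n] involves only the conditions [W m k] with k at most n, hence finitely many bits.
   So [least m] is locally constant and recording it does not refine the topology. *)
have supp m n : exists F : seq I, forall k, (k <= n)%N -> forall a b : I -> bool,
    {in F, a =1 b} -> (W m k a <-> W m k b).
  have [|||F FP] := @seq_choice _ _ (fun k F => forall a b : I -> bool,
    {in F, a =1 b} -> (W m k a <-> W m k b)) (iota 0 n.+1).
  - by move=> k G H GP a b ab; apply: GP => i iG; rewrite ab // mem_cat iG.
  - by move=> k G H GP a b ab; apply: GP => i iG; rewrite ab // mem_cat iG orbT.
  - move=> k; have [F FP] := WF m k; exists F => a b ab.
    by split; apply: FP => // i /ab.
  by exists F => k kn; apply: FP; rewrite mem_iota.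
apply: (@polish_of_codes R T _ code).
- move=> x A; rewrite cT; split=> -[F FA].
    exists (map inl F) => y yx; apply: FA => i iF.
    have := yx (inl i) (map_f _ iF) => /=.
    by case: (c y i); case: (c x i).
  have [|||G GP] := @seq_choice _ _ (fun j (G : seq I) => forall y,
    {in G, c y =1 c x} -> code y j = code x j) F.
  - by move=> k G H GP a ab; apply: GP => i iG; rewrite ab // mem_cat iG.
  - by move=> k G H GP a ab; apply: GP => i iG; rewrite ab // mem_cat iG orbT.
  - case=> [i|m] /=; first by exists [:: i] => y ->; rewrite ?inE.
    have [G GP] := supp m (least m x); exists G => y yx; apply/leastP.
    have [Ox xmin] := (leastP m x _).1 erefl.
    split; first by apply/(GP _ _ _ _ yx).
    by move=> k kx /(GP _ (ltnW kx) _ _ yx); exact: xmin.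
  by exists G => y yx; apply: FA => j /GP; exact.
- move=> x y xy; apply: cinj => i; have := xy (inl i) => /=.
  by case: (c y i); case: (c x i).
- move=> b bP; pose a i := b (inl i) != 0%N.
  have ab i : b (inl i) = a i.
    have [x /(_ (inl i))] := bP [:: inl i]; rewrite inE eqxx => /(_ isT).
    by rewrite /a /= => <-; case: (c x i).
  have aW m : W m (b (inr m)) a /\ forall k, (k < b (inr m))%N -> ~ W m k a.
    have [F FP] := supp m (b (inr m)).
    have [x xb] := bP (inr m :: map inl F).
    have xa : {in F, c x =1 a}.
      move=> i iF; have := xb (inl i); rewrite inE map_f // orbT => /(_ isT).
      by rewrite ab /=; case: (a i); case: (c x i).
    have /leastP[Ox xmin] : least m x = b (inr m).
      by apply: (xb (inr m)); rewrite inE eqxx.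
    split; first exact/(FP _ _ _ _ xa).
    by move=> k kb /(FP _ (ltnW kb) _ _ xa); exact: xmin.
  have [|x xa] := Pc a; first by apply/PW => m; exists (b (inr m)); case: (aW m).
  exists x => -[i|m] /=; first by rewrite ab xa.
  by apply/leastP; rewrite (funext xa : c x = a).
Qed.

(** The bits generate the Borel sets: basic open sets are finite Boolean combinations of bits and
    there are countably many of them, so every open set is a countable union of such
    combinations. *)
Lemma bits_borel_ind (P : set (set T)) : sigma_algebra [set: T] P ->
  (forall i, P [set x | c x i]) -> @borel T `<=` P.
Proof.
move=> sP Pc; apply: smallest_sub => //; have [P0 PCT PU] := sP.
have PC A : P A -> P (~` A) by move=> /PCT; rewrite setTD.
have PI A B : P A -> P B -> P (A `&` B).
  move=> PA PB; rewrite -[A `&` B]setCK setCI; apply: (PC).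
  by rewrite -bigcup2E; apply: PU => -[|[|n]] //=; exact: PC.
have Pq (q : seq (I * bool)) : P [set x | {in q, forall p, c x p.1 = p.2}].
  elim: q => [|[i b] q IH].
    rewrite (_ : mkset _ = setT); last by apply/seteqP; split.
    by rewrite -setC0; exact: PC.
  rewrite (_ : mkset _ = [set x | c x i = b] `&`
      [set x | {in q, forall p, c x p.1 = p.2}]).
    apply: PI => //; case: b; first exact: Pc.
    rewrite (_ : mkset _ = ~` [set x | c x i]); first exact/PC/Pc.
    by apply/seteqP; split=> x /=; [move->|move=> /negP/negbTE].
  apply/seteqP; split=> x /=.
    move=> xq; split; first by apply: (xq (i, b)); rewrite inE eqxx.
    by move=> p pq; apply: xq; rewrite inE pq orbT.
  by move=> [xi xq] p; rewrite inE => /predU1P[->//|/xq].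
move=> A oA.
pose E (q : seq (I * bool)) := [set x | {in q, forall p, c x p.1 = p.2}].
pose F n := if @unpickle (seq (I * bool)) n is Some q then
  [set x | E q `<=` A /\ E q x] else set0.
have PF n : P (F n).
  rewrite /F; case: (@unpickle (seq (I * bool)) n) => [q|//].
  have [qA|qA] := pselect (E q `<=` A).
    by rewrite (_ : mkset _ = E q); [exact: Pq|apply/seteqP; split=> x // []].
  by rewrite (_ : mkset _ = set0) //; apply/seteqP; split=> x // [].
rewrite (_ : A = \bigcup_n F n); first exact: PU.
apply/seteqP; split=> x.
  move=> Ax; have /cT[G GA] : nbhs x A by exact: open_nbhs_nbhs.
  exists (pickle [seq (i, c x i) | i <- G]) => //; rewrite /F pickleK /=.
  split=> [y /= yq|_ /mapP[i _ ->]//]; apply: GA => i iG.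
  by apply: (yq (i, c x i)); exact: map_f.
by case=> n _; rewrite /F; case: (@unpickle (seq (I * bool)) n) => // q [qA /qA].
Qed.

End Bits.

(** * Baire category in the infinite symmetric group *)

Definition cyl (s : seq nat) : set Sinf :=
  [set g | forall i, (i < size s)%N -> g (nth 0%N s i) = i].

Definition inv_seq (g : Sinf) n : seq nat := mkseq (g^-1 : Sinf)%g n.

Lemma Sinf_VK (g : Sinf) n : g ((g^-1 : Sinf)%g n) = n.
Proof. exact: Sinf_inv_funK. Qed.

Lemma Sinf_KV (g : Sinf) n : (g^-1 : Sinf)%g (g n) = n.
Proof. exact: Sinf_funK. Qed.

Lemma Sinf_inj (g : Sinf) : injective g.
Proof. exact: bij_inj (Sinf_bij g). Qed.

Lemma nth_prefix (s t : seq nat) i : prefix s t -> (i < size s)%N ->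
  nth 0%N t i = nth 0%N s i.
Proof. by move=> /prefixP[w ->] si; rewrite nth_cat si. Qed.

Lemma cyl_prefix s t : prefix s t -> cyl t `<=` cyl s.
Proof.
move=> st g tg i si; rewrite -(nth_prefix st si); apply: tg.
exact: leq_trans si (size_prefix st).
Qed.

Lemma cyl_nil g : cyl [::] g. Proof. by []. Qed.

Lemma cyl_compat s t g : cyl s g -> cyl t g -> (size s <= size t)%N ->
  prefix s t.
Proof.
move=> sg tg st; rewrite prefixE; apply/eqP.
apply: (@eq_from_nth _ 0%N); first by rewrite size_takel.
move=> i; rewrite size_takel // => si; rewrite nth_take //.
by apply: (@Sinf_inj g); rewrite sg // tg // (leq_trans si).
Qed.

Lemma cyl_uniq s g : cyl s g -> uniq s.
Proof.
move=> sg; apply/(uniqP 0%N) => i j si sj ij.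
by rewrite -(sg i) // -(sg j) // ij.
Qed.

Lemma cylM s (g h : Sinf) : cyl s (g * h : Sinf)%g <-> cyl (map h s) g.
Proof.
split=> sg i; last first.
  by move=> si; have := sg i; rewrite size_map => /(_ si); rewrite (nth_map 0%N).
by rewrite size_map => si; rewrite (nth_map 0%N) //; exact: sg.
Qed.

Lemma cyl_inv_seq g n : cyl (inv_seq g n) g.
Proof. by move=> i; rewrite size_mkseq => ni; rewrite nth_mkseq // Sinf_VK. Qed.
Arguments cyl_inv_seq : clear implicits.

Lemma prefix_inv_seq s g n : cyl s g -> (size s <= n)%N ->
  prefix s (inv_seq g n).
Proof. by move=> sg sn; apply: cyl_compat sg (cyl_inv_seq g n) _; rewrite size_mkseq. Qed.

Lemma nbhs_cyl s (g : Sinf) : cyl s g -> nbhs g (cyl s).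
Proof.
elim/last_ind: s => [_|s a IH sg].
  by apply: (filterS _ filterT) => h _; exact: cyl_nil.
have {}IH := IH (cyl_prefix (prefix_rcons s a) sg).
have ga : g a = size s.
  by have := sg (size s); rewrite size_rcons nth_rcons ltnn eqxx; apply.
apply: filterS2 IH (nbhs_Sinf g a) => h sh /= ha i.
rewrite size_rcons ltnS leq_eqVlt nth_rcons => /predU1P[->|si].
  by rewrite ltnn eqxx ha.
by rewrite si; exact: sh.
Qed.

Lemma open_cyl s : open (cyl s).
Proof. by rewrite openE => g; exact: nbhs_cyl. Qed.

Lemma cyl_basis (g : Sinf) (A : set Sinf) : nbhs g A ->
  exists N, forall n, (N <= n)%N -> cyl (inv_seq g n) `<=` A.
Proof.
have le n m : (n <= m)%N -> cyl (inv_seq g m) `<=` cyl (inv_seq g n).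
  move=> nm; apply: cyl_prefix; apply: prefix_inv_seq; last by rewrite size_mkseq.
  exact: cyl_inv_seq.
pose F : set_system Sinf := filter_from setT (fun n => cyl (inv_seq g n)).
have FF : Filter F.
  apply: filter_from_filter; first by exists 0%N.
  move=> i j _ _; exists (maxn i j) => // h ijh.
  by split; apply: le ijh; rewrite ?leq_maxl ?leq_maxr.
have /(_ A)Fg : F --> g.
  apply: (@cvg_Sinf F g FF) => n; exists (g n).+1 => // h /(_ (g n)).
  by rewrite size_mkseq ltnSn nth_mkseq // Sinf_KV => /(_ isT).
by move=> /Fg[N _ NA]; exists N => n Nn h /(le _ _ Nn); exact: NA.
Qed.

Lemma uniq_extend (s : seq nat) n : uniq s -> (size s <= n)%N ->
  exists t, [/\ prefix s t, uniq t & size t = n].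
Proof.
move=> us; elim: n => [|n IH]; first by case: s us => // us _; exists [::].
rewrite leq_eqVlt => /predU1P[<-|/IH[t [st ut tn]]].
  by exists s; rewrite prefix_refl.
exists (rcons t (\max_(i <- t) i).+1); split; rewrite ?size_rcons ?tn //.
  exact: prefix_trans st (prefix_rcons _ _).
rewrite rcons_uniq ut andbT; apply/negP => /(@leq_bigmax_seq _ t xpredT id).
by move=> /(_ isT); rewrite ltnn.
Qed.

(** Density among injective sequences only: the cylinder of a sequence with a repetition is
    empty. *)
Definition dense_seqs (D : set (seq nat)) :=
  forall s, uniq s -> exists t, [/\ prefix s t, uniq t & D t].

(* The lists [s n] grow to an enumeration of [nat] without repetitions, whose
   inverse is the required permutation. *)
Lemma Sinf_baire (D : nat -> set (seq nat)) s : (forall k, dense_seqs (D k)) ->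
  uniq s -> exists g, cyl s g /\ forall k, exists t, D k t /\ cyl t g.
Proof.
move=> dD us.
have /choice[f fP] : forall p : nat * seq nat, exists t, uniq p.2 ->
    [/\ prefix p.2 t, uniq t, p.1 \in t & exists2 t', D p.1 t' & prefix t' t].
  case=> k r; have [ur|] := boolP (uniq r); last by exists r.
  have [t [rt ut Dt]] := dD k r ur.
  have [kt|kt] := boolP (k \in t).
    by exists t => _; split=> //; exists t; rewrite ?prefix_refl.
  (* Appending a missing k makes every number occur in the growing list, so that the enumeration [h]
     below is onto. *)
  exists (rcons t k) => _; split; rewrite ?mem_rcons ?inE ?eqxx //=.
  - exact: prefix_trans rt (prefix_rcons _ _).
  - by rewrite rcons_uniq kt.
  - by exists t; rewrite ?prefix_rcons.
pose S := fix S n := if n is m.+1 then f (m, S m) else s.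
have uS n : uniq (S n) by elim: n => //= n /(fP (n, S n))[].
have SP n := fP (n, S n) (uS n).
have Sle m n : (m <= n)%N -> prefix (S m) (S n).
  elim: n => [|n IH]; first by rewrite leqn0 => /eqP ->; exact: prefix_refl.
  rewrite leq_eqVlt => /predU1P[->|/IH mn]; first exact: prefix_refl.
  by apply: prefix_trans mn _; case: (SP n).
have Smem k n : (k < n)%N -> k \in S n.
  by move=> /Sle/prefixP[w ->]; rewrite mem_cat; case: (SP k) => /= _ _ ->.
have Ssize n : (n <= size (S n))%N.
  rewrite -[leqLHS](size_iota 0 n); apply: uniq_leq_size (iota_uniq _ _) _ => k.
  by rewrite mem_iota => /Smem.
pose h n := nth 0%N (S n.+1) n.
have hS m i : (i < size (S m))%N -> nth 0%N (S m) i = h i.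
  move=> im; case: (leqP m i.+1) => mi.
    by rewrite /h (nth_prefix (Sle _ _ mi)).
  by rewrite (nth_prefix (Sle _ _ (ltnW mi))).
pose v k := index k (S k.+1).
have hv : cancel v h.
  by move=> k; rewrite -(hS k.+1) ?nth_index // ?index_mem Smem.
(* The positions i and [v (h i)] carry the same entry of one repetition-free list S, long enough to
   contain both. *)
have vh : cancel h v.
  move=> i; apply: (can_inj hv (x1 := v (h i))) => //.
  have hi j : (j < size (S (maxn i (v (h i))).+1))%N -> nth 0%N _ j = _ := hS _ j.
  have szM j : (j <= maxn i (v (h i)))%N -> (j < size (S (maxn i (v (h i))).+1))%N.
    by move=> jm; apply: leq_trans (Ssize _); rewrite ltnS.
  have : v (h i) = i.
    apply/eqP; rewrite -(nth_uniq 0%N _ _ (uS (maxn i (v (h i))).+1)) ?szM //;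
      rewrite ?leq_maxl ?leq_maxr //.
    by rewrite !hS ?szM ?leq_maxl ?leq_maxr // hv.
  by move=> ->.
pose g := mkSinf (Bijective hv vh).
have Sg n : cyl (S n) g by move=> i /hS ->; exact: vh.
exists g; split; first exact: (Sg 0%N).
move=> k; have [_ _ _ /= [t Dt tS]] := SP k.
by exists t; split=> //; exact: cyl_prefix tS _ (Sg k.+1).
Qed.

(** The usual notion: a dense open set is the union of the cylinders of a dense set of sequences. *)
Definition meager (A : set Sinf) := exists D : nat -> set (seq nat),
  (forall k, dense_seqs (D k)) /\
  forall g, (forall k, exists t, D k t /\ cyl t g) -> ~ A g.

Lemma sub_meager A B : A `<=` B -> meager B -> meager A.
Proof. by move=> AB [D [dD DB]]; exists D; split=> // g /DB gB /AB. Qed.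

Lemma meager0 : meager set0.
Proof.
exists (fun=> setT); split=> [k s us|g _ []//].
by exists s; split=> //; exact: prefix_refl.
Qed.

Lemma meager_exists (I : countType) (P : I -> Sinf -> Prop) :
  (forall i, meager [set g | P i g]) -> meager [set g | exists i, P i g].
Proof.
move=> /choice[D DP].
exists (fun k => if unpickle k is Some (i, n) then D i n else setT); split.
  move=> k; case: (@unpickle (I * nat)%type k) => [[i n]|]; first by case: (DP i).
  by move=> s us; exists s; split=> //; exact: prefix_refl.
move=> g gD [i Pi]; have [_ /(_ g)] := DP i; apply=> // n.
by have := gD (pickle (i, n)); rewrite pickleK.
Qed.

Lemma meagerU A B : meager A -> meager B -> meager (A `|` B).
Proof.
move=> mA mB; apply: (@sub_meager _ [set g | exists b : bool, (if b then A else B) g]).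
  by move=> g [Ag|Bg]; [exists true|exists false].
by apply: meager_exists => -[].
Qed.

Lemma cyl_nonmeager s : uniq s -> ~ meager (cyl s).
Proof. by move=> us [D [dD DP]]; have [g [sg /DP]] := Sinf_baire dD us. Qed.

(** A form of the Banach category theorem, easy because the cylinders are countably many: points in
    no good cylinder form a nowhere dense set, and the rest of C lies in a countable union of meager
    sets. *)
Lemma meager_local s C :
  (forall t, uniq t -> prefix s t ->
     exists w, [/\ uniq w, prefix t w & meager (cyl w `&` C)]) ->
  meager (cyl s `&` C).
Proof.
move=> sC.
pose D := [set t | (size s <= size t)%N /\ (prefix s t -> meager (cyl t `&` C))].
have dD : dense_seqs D.
  move=> t0 /uniq_extend /(_ (leq_maxl _ (size s)))[t [t0t ut st]].
  have {}st : (size s <= size t)%N by rewrite st leq_maxr.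
  have [pst|pst] := boolP (prefix s t); last first.
    by exists t; split=> //; split=> // pst'; rewrite pst' in pst.
  have [w [uw tw wC]] := sC t ut pst.
  exists w; split=> //; first exact: prefix_trans tw.
  by split=> //; exact: leq_trans (size_prefix tw).
apply: (@sub_meager _ ([set g | forall t, D t -> ~ cyl t g] `|`
    [set g | exists t, meager (cyl t `&` C) /\ (cyl t `&` C) g])).
  move=> g [sg Cg].
  have [[t [[st tC] tg]]|nD] := pselect (exists t, D t /\ cyl t g).
    by right; exists t; split=> //; apply: tC; exact: cyl_compat sg tg st.
  by left=> t Dt tg; apply: nD; exists t.
apply: meagerU.
  exists (fun _ => D); split=> // g /(_ 0%N)[t [Dt tg]] /(_ t Dt); exact.
apply: meager_exists => t.
have [tC|tC] := pselect (meager (cyl t `&` C)).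
  by apply: sub_meager tC => g [].
by apply: sub_meager meager0 => g [].
Qed.

Lemma meagerM (A : set Sinf) (h : Sinf) : meager A ->
  meager [set g | A (g * h : Sinf)%g].
Proof.
move=> [D [dD DA]]; exists (fun k => map h @` D k); split.
  move=> k s us.
  have [|t [st ut Dt]] := dD k (map (h^-1 : Sinf)%g s).
    by rewrite map_inj_uniq //; exact: Sinf_inj.
  exists (map h t); split; [|rewrite map_inj_uniq //; exact: Sinf_inj|by exists t].
  move/prefixP: st => [w ->]; rewrite map_cat -map_comp.
  by rewrite (eq_map (Sinf_VK h)) map_id prefix_prefix.
move=> g gD /=; apply: DA => k; have [_ [[t Dt <-] tg]] := gD k.
by exists t; split=> //; exact/cylM.
Qed.

(** * The Baire property and the category quantifier *)

(** Vaught's category quantifier on U_s. It is false for a sequence with a repetition, whose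
    cylinder is empty. *)
Definition often s (C : set Sinf) := ~ meager (cyl s `&` C).

(** The local form of the property of Baire: where C is not meager, it is comeager in some smaller
    cylinder. This form passes directly to complements and countable unions. *)
Definition baire_property (C : set Sinf) := forall s, uniq s ->
  often s C -> exists t, [/\ uniq t, prefix s t & meager (cyl t `\` C)].

Lemma often_sub s A B : A `<=` B -> often s A -> often s B.
Proof. by move=> AB sA sB; apply: sA; apply: sub_meager sB; exact: setIS. Qed.

Lemma often_prefix s t C : prefix s t -> often t C -> often s C.
Proof.
by move=> st tC sC; apply: tC; apply: sub_meager sC; apply: setSI; exact: cyl_prefix.
Qed.

Lemma often_nonempty s C : often s C -> exists2 g, cyl s g & C g.
Proof.
move=> sC; apply: contrapT => n; apply: sC; apply: sub_meager meager0 => g.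
by case=> sg Cg; apply: n; exists g.
Qed.

Lemma often_all s C : uniq s -> cyl s `<=` C -> often s C.
Proof. by move=> us sC; rewrite /often (setIidl sC); exact: cyl_nonmeager. Qed.

Lemma often_exists (I : countType) s (P : I -> Sinf -> Prop) :
  often s [set g | exists i, P i g] <-> exists i, often s [set g | P i g].
Proof.
split=> [sP|[i]]; last by apply: often_sub => g; exists i.
apply: contrapT => n; apply: sP.
apply: (@sub_meager _ [set g | exists i, (cyl s `&` [set g | P i g]) g]).
  by move=> g [sg [i Pi]]; exists i.
by apply: meager_exists => i; apply: contrapT => iP; apply: n; exists i.
Qed.

Lemma comeager_often s C : uniq s -> meager (cyl s `\` C) -> often s C.
Proof.
move=> us sC sC'; apply: (cyl_nonmeager us).
apply: (@sub_meager _ ((cyl s `\` C) `|` (cyl s `&` C))); last exact: meagerU.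
by move=> g sg; have [Cg|Cg] := pselect (C g); [right|left].
Qed.

(** If C is non-meager in all extensions of s, it is comeager in a dense family of cylinders, so its
    complement is meager in U_s by [meager_local]. Negation thereby becomes a quantifier over
    countably many sequences. *)
Lemma often_setC s C : baire_property C ->
  often s (~` C) <-> exists t, [/\ uniq t, prefix s t & ~ often t C].
Proof.
move=> bC; split=> [sC|[t [ut st tC]]].
  apply: contrapT => n; apply: sC; apply: meager_local => t ut st.
  have tC : often t C by apply: contrapT => tC; apply: n; exists t.
  by have [w [uw tw wC]] := bC t ut tC; exists w.
apply: (often_prefix st); apply: comeager_often => //.
by rewrite setDE setCK; exact: contrapT.
Qed.

Lemma comeagerP s C : baire_property C ->
  meager (cyl s `\` C) <-> forall t, uniq t -> prefix s t -> often t C.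
Proof.
move=> bC; have sC := often_setC s bC; rewrite /often -setDE in sC.
split=> [msC t ut st|sC'].
  apply: contrapT => tC.
  by suff /sC.2 : exists t, [/\ uniq t, prefix s t & ~ often t C] by []; exists t.
by apply: contrapT => /sC.1[t [ut st]]; apply; exact: sC'.
Qed.

Lemma baire_property_setC C : baire_property C -> baire_property (~` C).
Proof.
move=> bC s us /(often_setC s bC)[t [ut st tC]]; exists t; split=> //.
by rewrite setDE setCK; exact: contrapT.
Qed.

Lemma baire_property_exists (I : countType) (P : I -> Sinf -> Prop) :
  (forall i, baire_property [set g | P i g]) ->
  baire_property [set g | exists i, P i g].
Proof.
move=> bP s us /often_exists[i /(bP i s us)[t [ut st tP]]].
exists t; split=> //; apply: sub_meager tP => g [tg nP]; split=> // Pi.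
by apply: nP; exists i.
Qed.

Lemma often_open s C : open C -> often s C <-> exists2 g, cyl s g & C g.
Proof.
move=> oC; split; first exact: often_nonempty.
move=> [g sg Cg]; have /cyl_basis[N NC] : nbhs g C by exact: open_nbhs_nbhs.
apply: (often_prefix (prefix_inv_seq sg (leq_maxr N _))).
apply: often_all; first exact: cyl_uniq (cyl_inv_seq g _).
by apply: NC; rewrite leq_maxl.
Qed.

Lemma baire_property_open C : open C -> baire_property C.
Proof.
move=> oC s us /(often_open s oC)[g sg Cg].
have /cyl_basis[N NC] : nbhs g C by exact: open_nbhs_nbhs.
exists (inv_seq g (maxn N (size s))); split.
- exact: cyl_uniq (cyl_inv_seq g _).
- by apply: prefix_inv_seq => //; rewrite leq_maxr.
- by apply: sub_meager meager0 => h [/(NC _ (leq_maxl _ _))].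
Qed.

(** Right translation by h carries U_s onto the cylinder of the sequence with entries h^-1 s_i. The
    logic action moves arguments in the same way, whence the equivariance of the codes. *)
Lemma oftenM s C (h : Sinf) : often s [set g | C (g * h : Sinf)%g] <->
  often (map (h^-1 : Sinf)%g s) C.
Proof.
have sE : map h (map (h^-1 : Sinf)%g s) = s.
  by rewrite -map_comp (eq_map (Sinf_VK h)) map_id.
split=> sC mC; apply: sC.
  have := meagerM h mC; apply: sub_meager => g [sg Cg]; split=> //.
  by apply/cylM; rewrite sE.
have := meagerM (h^-1)%g mC; apply: sub_meager => g [sg Cg].
split; first exact/cylM.
by have gE : (g * h^-1 * h)%g = g := mulgVK h g; rewrite /= gE.
Qed.

Lemma pairl_continuous (S T : topologicalType) (y : T) :
  continuous (fun x : S => (x, y)).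
Proof.
move=> x A [[P Q] /= [Px Qy] PQ]; apply: filterS Px => z Pz.
by apply: (PQ (z, y)); split=> //; exact: nbhs_singleton Qy.
Qed.

Lemma pairr_continuous (S T : topologicalType) (x : S) :
  continuous (fun y : T => (x, y)).
Proof.
move=> y A [[P Q] /= [Px Qy] PQ]; apply: filterS Qy => z Qz.
by apply: (PQ (x, z)); split=> //; exact: nbhs_singleton Px.
Qed.

(** Both claims go through one induction, because the complement step for the second uses the Baire
    property of the sections. For an open set, non-meager means nonempty, and a single g witnesses
    this for all nearby x. *)
Lemma montgomery_novikov (X : topologicalType) (B : set (Sinf * X)) : borel B ->
  (forall x, baire_property [set g | B (g, x)]) /\
  (forall s, borel [set x | often s [set g | B (g, x)]]).
Proof.
move: B; apply: borel_ind.
- move=> B oB; have oBx x : open [set g | B (g, x)].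
    by have /continuousP/(_ B oB) := @pairl_continuous Sinf X x.
  split=> [x|s]; first exact: baire_property_open.
  apply: borel_open; rewrite openE => x /= /(often_open _ (oBx x))[g sg Bg].
  have /continuousP/(_ B oB) := @pairr_continuous Sinf X g; rewrite openE => /(_ x Bg).
  by apply: filterS => y By; apply: (often_open s (oBx y)).2; exists g.
- move=> B [bp bB]; split=> [x|s]; first exact: baire_property_setC (bp x).
  rewrite (_ : [set x | _] = [set x | exists t,
      [/\ uniq t, prefix s t & ~ often t [set g | B (g, x)]]]).
    apply: borel_exists => t.
    rewrite (_ : [set x | _] = [set x | uniq t /\ prefix s t /\
        ~ often t [set g | B (g, x)]]).
      apply: borel_and; first exact: borel_const.
      by apply: borel_and; [exact: borel_const|exact: borel_not].
    by apply/seteqP; split=> x /=; [case|move=> [? []]].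
  by apply/seteqP; split=> x /=; move/(often_setC s (bp x)).
- move=> F bF; split=> [x|s].
    rewrite (_ : mkset _ = [set g | exists i, F i (g, x)]).
      by apply: baire_property_exists => i; case: (bF i).
    by apply/seteqP; split=> g [i]; exists i.
  rewrite (_ : [set x | _] = [set x | exists i, often s [set g | F i (g, x)]]).
    by apply: borel_exists => i; case: (bF i).
  apply/seteqP; split=> x /=.
    move=> sF; apply/often_exists; apply: often_sub sF => g [i _ Fi].
    by exists i.
  by move=> /often_exists; apply: often_sub => g [i Fi]; exists i.
Qed.

(** * The logic action *)

Lemma structure_ext (L : language) (x y : structure L) :
  (forall i s, x i s = y i s) -> x = y.
Proof.
by move=> xy; apply: functional_extensionality_dep => i; apply/funext => s; exact: xy.
Qed.

Section LogicAction.
Variable L : language.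
Implicit Types (x y : structure L) (g h : Sinf).

Definition bit_index : countType := {i : symbol L & (arity i).-tuple nat}.

Definition bit x (p : bit_index) : bool := x (tag p) (tagged p).

Definition act_index g (p : bit_index) : bit_index :=
  Tagged (fun i => (arity i).-tuple nat) (map_tuple (g^-1 : Sinf)%g (tagged p)).

Lemma bit_inj x y : bit x =1 bit y -> x = y.
Proof.
move=> xy; apply: structure_ext => i s.
exact: (xy (Tagged (fun i => (arity i).-tuple nat) s)).
Qed.

Lemma bit_act g x p : bit (logic_action g x) p = bit x (act_index g p).
Proof. by []. Qed.

Lemma nbhs_bit x p : nbhs x [set y | bit y p = bit x p].
Proof.
case: p => i s.
have cv : continuous (fun y : structure L => bit y (existT _ i s)).
  move=> y; apply: (@continuous_comp (structure L)
    {ptws (arity i).-tuple nat -> bool} bool (fun y => y i) (@^~ s)).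
    exact: (@proj_continuous (symbol L)
      (fun i => {ptws (arity i).-tuple nat -> bool}) i).
  exact: (@proj_continuous ((arity i).-tuple nat) (fun=> bool) s).
apply: (cv x [set b | b = bit x (existT _ i s)]).
by rewrite nbhs_principalE; apply/principal_filterP.
Qed.

Lemma structure_bits : bit_topology bit.
Proof.
move=> x A; split=> [|[F FA]]; last first.
  suff : nbhs x [set y | {in F, bit y =1 bit x}] by exact: filterS.
  elim: F {FA} => [|p F IH]; first by apply: (filterS _ filterT).
  apply: filterS2 (nbhs_bit x p) IH => y /= yp yF q.
  by rewrite inE => /predU1P[->|/yF].
pose E (F : seq bit_index) := [set y | {in F, bit y =1 bit x}].
pose G : set_system (structure L) := filter_from setT E.
have GF : Filter G.
  apply: filter_from_filter; first by exists [::].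
  move=> F F' _ _; exists (F ++ F') => // y yFF'.
  by split=> p pF; apply: yFF'; rewrite mem_cat pF ?orbT.
suff Gx : G --> x by move=> /Gx[F _ FA]; exists F.
apply/cvg_sup => i C [_ [[D oD <-] Dx] DC].
apply: (@filterS _ G _ _ _ DC).
suff Gxi : (fun y : structure L => y i) @ G --> (x i : {ptws (arity i).-tuple nat -> bool}).
  by apply: Gxi; exact: open_nbhs_nbhs.
apply/cvg_sup => s C' [_ [[D' oD' <-] D'x] D'C].
exists [:: existT _ i s : bit_index] => // y yx; apply: D'C => /=.
have := yx (existT _ i s); rewrite inE eqxx => /(_ isT); rewrite /bit /= => yxE.
by move: D'x; rewrite /= -yxE.
Qed.

End LogicAction.

Lemma borel_bit (L : language) (p : bit_index L) :
  borel [set x : structure L | bit x p].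
Proof.
apply: borel_open; rewrite openE => x xp.
by apply: filterS (nbhs_bit x p) => y /= ->.
Qed.

(** An action that permutes the bits is continuous once each bit is moved in a way locally constant
    in g. This serves the logic action and, later, the space of models. *)
Lemma action_continuous (T : topologicalType) (I : countType) (c : T -> I -> bool)
    (a : Sinf -> T -> T) (tau : Sinf -> I -> I) :
  bit_topology c -> (forall g x i, c (a g x) i = c x (tau g i)) ->
  (forall g i, nbhs g [set h | tau h i = tau g i]) ->
  continuous (fun p : Sinf * T => a p.1 p.2).
Proof.
move=> cT atau tauc [g x] A /cT[F FA].
exists ([set h : Sinf | {in F, forall i, tau h i = tau g i}],
        [set y | {in map (tau g) F, c y =1 c x}]) => /=; last first.
  move=> [h y] [/= hF yF]; apply: FA => i iF /=.
  by rewrite !atau hF // yF // map_f.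
split; last by apply/cT; exists (map (tau g) F).
elim: F {FA} => [|i F IH]; first by apply: (filterS _ filterT).
apply: filterS2 (tauc g i) IH => h /= hi hF j.
by rewrite inE => /predU1P[->|/hF].
Qed.

Lemma nbhs_inv (g : Sinf) n :
  nbhs g [set h : Sinf | (h^-1 : Sinf)%g n = (g^-1 : Sinf)%g n].
Proof. exact: (@Sinf_invg_continuous g _ (nbhs_Sinf (g^-1)%g n)). Qed.

Lemma nbhs_map_inv (g : Sinf) (s : seq nat) :
  nbhs g [set h : Sinf | map (h^-1 : Sinf)%g s = map (g^-1 : Sinf)%g s].
Proof.
elim: s => [|n s IH]; first by apply: (filterS _ filterT).
by apply: filterS2 (nbhs_inv g n) IH => h /= -> ->.
Qed.

Lemma logic_action_is_action (L : language) : is_action (@logic_action L).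
Proof.
split=> [x|g h x]; apply: structure_ext => i s; rewrite /logic_action.
  congr (x i _); apply: val_inj => /=; rewrite -[RHS]map_id; apply: eq_map => n.
  by rewrite invg1.
congr (x i _); apply: val_inj; rewrite /= -map_comp; apply: eq_map => n.
by rewrite invgM.
Qed.

Lemma polish_structure (R : realType) (L : language) : polish R (structure L).
Proof.
apply: (@polish_of_bits R _ _ _ (@structure_bits L) (fun=> True)) => //.
- exact: bit_inj.
- exact/pi02_finsupp/finsupp_const.
- by move=> a _; exists (fun i s => a (existT _ i s)) => -[i s].
Qed.

Lemma nbhs_act_index (L : language) (g : Sinf) (i : bit_index L) :
  nbhs g [set h | act_index h i = act_index g i].
Proof.
case: i => i s; apply: filterS (nbhs_map_inv g s) => h /= hs.
by rewrite /act_index /=; congr (Tagged _ _); exact: val_inj.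
Qed.

Lemma logic_action_continuous (L : language) :
  continuous (fun p : Sinf * structure L => logic_action p.1 p.2).
Proof.
exact: action_continuous (@structure_bits L) (@bit_act L) (@nbhs_act_index L).
Qed.

Lemma logic_polish_space (R : realType) (L : language) :
  polish_space R (@logic_action L).
Proof.
split; [exact: polish_structure|exact: logic_action_is_action|].
exact: logic_action_continuous.
Qed.

Lemma polish_borel_space (R : realType) (G : topGroupType) (X : topologicalType)
  (a : G -> X -> X) : polish_space R a -> borel_space R a.
Proof. by case=> ? ? ?; split=> //; exact: continuous_borel_map. Qed.

Lemma isomorphicE (L : language) :
  @isomorphic L = same_orbit (@logic_action L).
Proof.
apply/funext => x; apply/funext => y; apply/propext; split=> [[f fbij fxy]|[g <-]].
  exists (mkSinf fbij); apply: structure_ext => i s.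
  rewrite /logic_action -fxy; congr (y i _); apply: val_inj => /=.
  by rewrite -map_comp -[RHS]map_id; apply: eq_map => n; exact: (Sinf_VK (mkSinf fbij) n).
exists (Sinf_fun g); first exact: Sinf_bij.
move=> i s; rewrite /logic_action; congr (x i _); apply: val_inj => /=.
by rewrite -map_comp -[RHS]map_id; apply: eq_map => n; exact: (Sinf_KV g n).
Qed.

Lemma borel_sat (L : language) n (phi : formula L n) (v : n.-tuple nat) :
  borel [set x | sat x phi v].
Proof.
elim: n / phi v => [n j k|n i t|n phi IH|n phi IH|n phi IH|n phi IH|n phi IH] v /=.
- exact: borel_const.
- exact: (@borel_bit L (existT _ i (map_tuple (tnth v) t))).
- by apply: borel_not; exact: IH.
- by apply: borel_forall => k; exact: IH.
- by apply: borel_exists => k; exact: IH.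
- by apply: borel_forall => a; exact: IH.
- by apply: borel_exists => a; exact: IH.
Qed.

(** * Definability of Vaught transforms *)

Section Definable.
Variable L : language.
Implicit Types (P Q : structure L -> seq nat -> Prop) (n : nat).

(* A quantifier binds the first variable, whereas the sequences [t] of [often t]
   grow at the end: hence the reversal. *)
Definition definable n P := exists phi : formula L n,
  forall x (v : n.-tuple nat), sat x phi v <-> P x (rev v).

Lemma definable_ext n P Q :
  (forall x t, size t = n -> P x t <-> Q x t) -> definable n P -> definable n Q.
Proof.
move=> PQ [phi phiP]; exists phi => x v; rewrite phiP; apply: PQ.
by rewrite size_rev size_tuple.
Qed.

Lemma definable_const n (C : Prop) : definable n (fun _ _ => C).
Proof.
(* For n = 0 no variable is available, hence the quantifier. *)
pose T := Forall (@Equal L n.+1 ord0 ord0).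
by have [c|c] := pselect C; [exists T|exists (Not T)] => x v /=; split=> // /(_ (fun=> erefl)).
Qed.

Lemma definable_not n P : definable n P -> definable n (fun x t => ~ P x t).
Proof. by move=> [phi phiP]; exists (Not phi) => x v /=; rewrite phiP. Qed.

Lemma definable_exists (I : countType) n (P : I -> structure L -> seq nat -> Prop) :
  (forall i, definable n (P i)) -> definable n (fun x t => exists i, P i x t).
Proof.
move=> dP.
have /choice[phi phiP] k : definable n (fun x t => if unpickle k is Some i
    then P i x t else False).
  by case: unpickle => [i|]; [exact: dP|exact: definable_const].
exists (Or phi) => x v /=; split=> [[k /phiP]|[i Pi]].
  by case: unpickle => // i; exists i.
by exists (pickle i); apply/phiP; rewrite pickleK.
Qed.

Lemma definable_forall (I : countType) n (P : I -> structure L -> seq nat -> Prop) :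
  (forall i, definable n (P i)) -> definable n (fun x t => forall i, P i x t).
Proof.
move=> dP; apply: (@definable_ext n (fun x t => ~ exists i, ~ P i x t)).
  by move=> x t _; split=> [/forallNP Pt i|Pt [i]//]; exact: contrapT.
by apply: definable_not; apply: definable_exists => i; exact: definable_not.
Qed.

Lemma definable_and n P Q : definable n P -> definable n Q ->
  definable n (fun x t => P x t /\ Q x t).
Proof.
move=> dP dQ; apply: (@definable_ext n (fun x t =>
    forall b : bool, (if b then P else Q) x t)).
  by move=> x t _; split=> [PQ|[? ?] []//]; split; [exact: (PQ true)|exact: (PQ false)].
by apply: definable_forall => -[].
Qed.

Lemma definable_quant n P : definable n.+1 P ->
  definable n (fun x t => exists a, P x (rcons t a)).
Proof.
move=> [phi phiP]; exists (Exists phi) => x v /=.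
by split=> -[a]; [move/phiP|move=> Pa; exists a; apply/phiP];
  rewrite /= rev_cons => //; exists a.
Qed.

(** A countable disjunction over the length of w, with a block of existential quantifiers for each
    length. *)
Lemma definable_cat P : (forall n, definable n P) ->
  forall n, definable n (fun x t => exists w, P x (t ++ w)).
Proof.
move=> dP n.
have dk k : forall m, definable m (fun x t => exists2 w, size w = k & P x (t ++ w)).
  elim: k => [|k IH] m.
    apply: definable_ext (dP m) => x t _; split=> [Pt|[w /size0nil ->]].
      by exists [::]; rewrite // cats0.
    by rewrite cats0.
  apply: definable_ext (definable_quant (IH m.+1)) => x t _.
  split=> [[a [w wk]]|[[//|a w] [wk]]].
    by rewrite cat_rcons => Pw; exists (a :: w); rewrite //= wk.
  by exists a, w => //; rewrite cat_rcons.
apply: (definable_ext _ (@definable_exists nat n _ (fun k => dk k n))) => x t _.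
by split=> [[k [w _ Pw]]|[w Pw]]; [exists w|exists (size w), w].
Qed.

Lemma definable_nth_eq n i j : (i < n)%N -> (j < n)%N ->
  definable n (fun _ t => nth 0%N t i = nth 0%N t j).
Proof.
move=> ni nj; exists (Equal L (rev_ord (Ordinal ni)) (rev_ord (Ordinal nj))).
by move=> x v /=; rewrite !(tnth_nth 0%N) /= !nth_rev ?size_tuple.
Qed.

Lemma definable_uniq n : definable n (fun _ t => uniq t).
Proof.
apply: (@definable_ext n (fun _ t => forall p : 'I_n * 'I_n,
    ~ (p.1 != p.2 /\ nth 0%N t p.1 = nth 0%N t p.2))).
  move=> x t tn; split=> [tP|/(uniqP 0%N) tP [i j] [/= ij tij]].
    apply/(uniqP 0%N) => i j; rewrite !inE tn => ni nj tij; apply: contrapT => /eqP ij.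
    by case: (tP (Ordinal ni, Ordinal nj)).
  by case/eqP: ij; apply: val_inj; apply: tP; rewrite ?inE ?tn //; exact: ltn_ord.
apply: definable_forall => -[i j]; apply: definable_not; apply: definable_and.
  exact: definable_const.
exact: definable_nth_eq.
Qed.

(** The entries of s are positions in t. The guard excludes positions past the end of t, where [nth]
    would return its default. *)
Lemma definable_rel n i (s : (arity i).-tuple nat) : definable n (fun x t =>
  all (fun k => (k < size t)%N) s /\ x i (map_tuple (nth 0%N t) s)).
Proof.
have [sn|sn] := boolP (all (fun k => (k < n)%N) s); last first.
  apply: definable_ext (definable_const n False) => x t ->.
  by split=> // -[sn']; rewrite sn' in sn.
have /choice[u us] : forall k : 'I_(arity i), exists j : 'I_n, val j = tnth s k.
  by move=> k; have /allP/(_ _ (mem_tnth k s)) kn := sn; exists (Ordinal kn).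
exists (Rel (mktuple (fun k => rev_ord (u k)))) => x v /=.
rewrite size_rev size_tuple sn.
suff -> : map_tuple (tnth v) (mktuple (fun k => rev_ord (u k))) =
    map_tuple (nth 0%N (rev v)) s by split=> [|[]].
apply: eq_from_tnth => k; rewrite !tnth_map tnth_ord_tuple (tnth_nth 0%N) /=.
by rewrite -us nth_rev size_tuple //; exact: ltn_ord.
Qed.

Lemma logic_baire_property (B : set (structure L)) x : borel B ->
  baire_property [set g | B (logic_action g x)].
Proof.
move=> /(continuous_borel_map (@logic_action_continuous L))/montgomery_novikov[bp _].
exact: bp.
Qed.

(** On U_w the inverse of g sends k to w_k for each position k in w, so a long enough w decides the
    bit. The set of g in question is open, hence non-meager in U_t exactly when some injective
    extension of t decides the bit positively. *)
Lemma definable_often_bit (p : bit_index L) n :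
  definable n (fun x t => often t [set g | bit (logic_action g x) p]).
Proof.
case: p => i s.
pose P (x : structure L) (t : seq nat) := uniq t /\ all (fun k => (k < size t)%N) s /\
  x i (map_tuple (nth 0%N t) s).
apply: (@definable_ext n (fun x t => exists w, P x (t ++ w))); last first.
  apply: (@definable_cat P) => m.
  by apply: definable_and; [exact: definable_uniq|exact: definable_rel].
move=> x t _; split=> [[w [uw [sw xw]]]|/often_nonempty[g tg xg]].
  apply: (often_prefix (prefix_prefix t w)); apply: often_all => // g gw.
  rewrite /= bit_act /bit /act_index /=.
  suff -> : map_tuple (g^-1 : Sinf)%g s = map_tuple (nth 0%N (t ++ w)) s by [].
  apply: val_inj => /=; apply/eq_in_map => k /(allP sw) kw.
  by rewrite -[in LHS](gw k kw) Sinf_KV.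
pose m := maxn (\max_(k <- s) k.+1) (size t).
have /prefixP[w wE] := prefix_inv_seq tg (leq_maxr _ _ : (size t <= m)%N).
have sm k : k \in (s : seq nat) -> (k < m)%N.
  move=> ks; apply: leq_trans (leq_maxl _ _).
  exact: (@leq_bigmax_seq _ s xpredT succn).
exists w; rewrite /P -wE; split; first exact: cyl_uniq (cyl_inv_seq g m).
split; first by apply/allP => k /sm; rewrite size_mkseq.
move: xg; rewrite /= bit_act /bit /act_index /=.
suff -> : map_tuple (g^-1 : Sinf)%g s = map_tuple (nth 0%N (inv_seq g m)) s by [].
by apply: val_inj => /=; apply/eq_in_map => k /sm km; rewrite nth_mkseq.
Qed.

(** Borelness is carried through the induction because the complement step needs the Baire property
    of the sections. *)
Lemma definable_often (B : set (structure L)) : borel B -> forall n,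
  definable n (fun x t => often t [set g | B (logic_action g x)]).
Proof.
move=> bB; have : [set B | borel B /\ forall n,
  definable n (fun x t => often t [set g | B (logic_action g x)])] B; last by case.
apply: (bits_borel_ind (@structure_bits L)) bB.
  split.
  - split=> [|n]; first exact: borel_open open0.
    apply: definable_ext (definable_const n False) => x t _.
    by split=> // /often_nonempty[].
  - move=> A [bA dA]; rewrite setTD; split=> [|n]; first exact: borel_setC.
    pose P (x : structure L) (t : seq nat) :=
      uniq t /\ ~ often t [set g | A (logic_action g x)].
    apply: (@definable_ext n (fun x t => exists w, P x (t ++ w))); last first.
      apply: (@definable_cat P) => m.
      apply: definable_and; first exact: definable_uniq.
      by apply: definable_not; exact: dA.
    move=> x t _; have := often_setC t (@logic_baire_property A x bA).
    rewrite -[~` [set g | _]]/[set g | (~` A) (logic_action g x)] => ->.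
    split=> [[w [uw tw]]|[r [ur /prefixP[w rE] tr]]].
      by exists (t ++ w); split=> //; exact: prefix_prefix.
    by exists w; rewrite /P -rE.
  - move=> F dF; split=> [|n]; first by apply: borel_bigcup => k; case: (dF k).
    apply: definable_ext (@definable_exists nat n _ (fun k => (dF k).2 n)) => x t _.
    split=> [/often_exists|tF].
      by apply: often_sub => g [k Fk]; exists k.
    by apply/often_exists; apply: often_sub tF => g [k _ Fk]; exists k.
by move=> p; split=> [|n]; [exact: borel_bit|exact: definable_often_bit].
Qed.

(** For invariant B, the set of g with g x in B is everything or empty, so the category quantifier
    over the whole group reduces to membership of x. *)
Lemma lopez_escobar (B : set (structure L)) : borel B ->
  Defs.invariant (@logic_action L) B -> exists phi : sentence L, models phi = B.
Proof.
move=> bB iB; have [phi phiP] := definable_often bB 0.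
exists phi; apply/seteqP; split=> x; rewrite /models /=.
  move/phiP => /often_nonempty[g _ /= /(iB g^-1%g)].
  have [la1 laM] := logic_action_is_action L.
  by rewrite -laM mulVg la1.
by move=> Bx; apply/phiP; apply: often_all => // g _; exact: iB.
Qed.

End Definable.

(** * The Vaught embedding *)

Lemma borel_map_comp (S T U : topologicalType) (f : S -> T) (g : T -> U) :
  borel_map f -> borel_map g -> borel_map (g \o f).
Proof. by move=> bf bg B /bg /bf. Qed.

Lemma borel_map_bits (T : topologicalType) (L : language) (f : T -> structure L) :
  (forall p, borel [set x | bit (f x) p]) -> borel_map f.
Proof.
move=> fb; apply: (bits_borel_ind (@structure_bits L)) => //; split.
- by rewrite /= preimage_set0; exact: borel_open open0.
- by move=> A; rewrite setTD /= preimage_setC; exact: borel_setC.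
- by move=> F bF; rewrite /= preimage_bigcup; exact: borel_bigcup.
Qed.

Lemma dense_seq (R : realType) (T : topologicalType) (d : T -> T -> R) (x0 : T) :
  complete_metric d -> Defs.separable T ->
  exists D : nat -> T, forall x (e : R), 0 < e -> exists n, d (D n) x < e.
Proof.
move=> dP /(separable_seq x0)[D DP]; exists D => x e e0.
have [|n] := DP _ (open_dball dP x e); first by exists x; rewrite /= distxx.
by exists n; rewrite (distC dP).
Qed.

(** * Borel dependence of limits on parameters *)

Section BorelLimit.
Variables (R : realType) (X Q : topologicalType) (d : X -> X -> R).
Variables (D : nat -> X) (i : nat -> Q -> nat) (x0 : X).
Hypothesis dP : complete_metric d.
Hypothesis bi : forall j n, borel [set q | i j q = n].

Let borel_index (P : nat -> Prop) j : borel [set q | P (i j q)].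
Proof.
rewrite (_ : mkset _ = [set q | exists n, i j q = n /\ P n]).
  by apply: borel_exists => n; apply: borel_and; [exact: bi|exact: borel_const].
by apply/seteqP; split=> q /= => [?|[n [-> //]]]; exists (i j q).
Qed.

Let borel_index2 (P : nat -> nat -> Prop) j k : borel [set q | P (i j q) (i k q)].
Proof.
rewrite (_ : mkset _ = [set q | exists n, i j q = n /\ P n (i k q)]).
  by apply: borel_exists => n; apply: borel_and; [exact: bi|exact: borel_index].
by apply/seteqP; split=> q /= => [?|[n [-> //]]]; exists (i j q).
Qed.

Let cauchy q := forall m, exists N, forall j k, (N <= j)%N -> (N <= k)%N ->
  d (D (i j q)) (D (i k q)) < m.+1%:R^-1.

Let borel_cauchy : borel [set q | cauchy q].
Proof.
apply: borel_forall => m; apply: borel_exists => N.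
apply: borel_forall => j; apply: borel_forall => k.
apply: borel_imply; first exact: borel_const.
apply: borel_imply; first exact: borel_const.
exact: (borel_index2 (fun n n' => d (D n) (D n') < m.+1%:R^-1)).
Qed.

Let cauchyP q : cauchy q <-> exists x : X, (fun j => D (i j q)) @ \oo --> x.
Proof.
split=> [qC|[x /(cvg_distP dP) qx] m].
  apply: (dist_complete dP) => e /invS_small[m me]; have [N NP] := qC m.
  by exists N => j k Nj Nk; apply: lt_trans me; exact: NP.
have m0 : 0 < m.+1%:R^-1 / 2 :> R by rewrite divr_gt0 // invr_gt0 ltr0n.
have [N NP] := qx _ m0; exists N => j k Nj Nk.
apply: le_lt_trans (dist_tri dP _ x _) _; rewrite [ltRHS]splitr.
by rewrite ltrD //; [|rewrite (distC dP)]; exact: NP.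
Qed.

(** Sequences are given by indices in [nat], so any condition on finitely many terms is a countable
    union over index values. The limit lies in U exactly when balls of one fixed radius about all
    late terms lie in U; where there is no limit, the value is [x0]. *)
Lemma borel_limit : exists z : Q -> X, borel_map z /\
  forall q (x : X), (fun j => D (i j q)) @ \oo --> x -> z q = x.
Proof.
pose z q := if pselect (exists x : X, (fun j => D (i j q)) @ \oo --> x) is left h
  then projT1 (cid h) else x0.
have zP q (x : X) : (fun j => D (i j q)) @ \oo --> x -> z q = x.
  rewrite /z; case: pselect => [h|n qx]; last by case: n; exists x.
  by case: cid => /= y qy qx; exact: (cvg_dist_unique dP qy qx).
exists z; split=> //; apply: open_borel_map => U oU.
rewrite (_ : z @^-1` U = [set q | (cauchy q /\ exists m N, forall j, (N <= j)%N ->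
    [set y | d (D (i j q)) y < m.+1%:R^-1] `<=` U) \/ (~ cauchy q /\ U x0)]).
  apply: borel_or; apply: borel_and.
  - exact: borel_cauchy.
  - apply: borel_exists => m; apply: borel_exists => N; apply: borel_forall => j.
    apply: borel_imply; first exact: borel_const.
    exact: (borel_index (fun n => [set y | d (D n) y < m.+1%:R^-1] `<=` U)).
  - exact: borel_not borel_cauchy.
  - exact: borel_const.
have zn q : ~ cauchy q -> z q = x0.
  by rewrite /z; case: pselect => // h []; exact/cauchyP.
apply/seteqP; split=> q /=.
  have [qC|qC] := pselect (cauchy q); last by rewrite zn //; right.
  have [x qx] := (cauchyP q).1 qC; rewrite (zP _ _ qx) => Ux; left; split=> //.
  have /(nbhs_ballP dP)[e e0 eU] : nbhs x U by exact: open_nbhs_nbhs.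
  have e2 : 0 < e / 2 by rewrite divr_gt0.
  have [m me] := invS_small e2; have [N NP] := (cvg_distP dP _ _).1 qx _ e2.
  exists m, N => j Nj y /= jy; apply: eU.
  apply: le_lt_trans (dist_tri dP _ (D (i j q)) _) _.
  rewrite [ltRHS]splitr ltrD //; last exact: lt_trans me.
  by rewrite (distC dP); exact: NP.
move=> [[qC [m [N NP]]]|[/zn -> //]].
have [x qx] := (cauchyP q).1 qC; rewrite (zP _ _ qx).
have m0 : 0 < m.+1%:R^-1 :> R by rewrite invr_gt0 ltr0n.
have [N' N'P] := (cvg_distP dP _ _).1 qx _ m0.
apply: (NP (maxn N N')); first exact: leq_maxl.
by rewrite /=; apply: N'P; exact: leq_maxr.
Qed.

End BorelLimit.

(** The exponent of 2 in m takes each value for arbitrarily large m, so each pair recurs in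
    unboundedly many arities. *)
Definition recurrent_pair (m : nat) : nat * nat :=
  odflt (0, 0)%N (unpickle (logn 2 m)).

Lemma recurrent_pairP p n : exists2 m, (n <= m)%N & recurrent_pair m = p.
Proof.
(* The factor [3 ^ n] exceeds n without changing the exponent of 2. *)
exists (2 ^ pickle p * 3 ^ n)%N.
  apply: leq_trans (ltnW (ltn_expl n (isT : 1 < 3)%N)) _.
  by rewrite leq_pmull // expn_gt0.
rewrite /recurrent_pair lognM ?expn_gt0 // pfactorK // lognX.
by rewrite muln0 addn0 pickleK.
Qed.

Section VaughtEmbedding.
Variables (R : realType) (X : topologicalType) (a : Sinf -> X -> X).
Variables (d : X -> X -> R) (D : nat -> X) (x0 : X).
Hypothesis aP : is_action a.
Hypothesis ba : borel_map (fun p : Sinf * X => a p.1 p.2).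
Hypothesis dP : complete_metric d.
Hypothesis DP : forall x (e : R), 0 < e -> exists n, d (D n) x < e.

Let Y := structure L_infty.

Let dball (p : nat * nat) : set X := [set x | d (D p.1) x < p.2.+1%:R^-1].

Definition vaught_code (x : X) : Y := fun m s =>
  `[< often s [set g | dball (recurrent_pair m) (a g x)] >].

Let seq_bit (y : Y) (w : seq nat) : bool := y (size w) (in_tuple w).

Let vaught_codeE x w : seq_bit (vaught_code x) w <->
  often w [set g | dball (recurrent_pair (size w)) (a g x)].
Proof. by split=> /asboolP. Qed.

Let borel_hit p : borel [set q : Sinf * X | dball p (a q.1 q.2)].
Proof. exact: (ba (borel_open (open_dball dP _ _))). Qed.

Let baire_hit x p : baire_property [set g | dball p (a g x)].
Proof. by have [bp _] := montgomery_novikov (borel_hit p); exact: bp. Qed.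

Let vaught_code_act g x : vaught_code (a g x) = logic_action g (vaught_code x).
Proof.
apply: structure_ext => m s; apply: asbool_equiv_eq.
rewrite -(oftenM s [set h | dball (recurrent_pair m) (a h x)] g).
suff -> : [set h : Sinf | dball (recurrent_pair m) (a h (a g x))] =
  [set h | [set h | dball (recurrent_pair m) (a h x)] (h * g : Sinf)%g] by [].
by apply/seteqP; split=> h /=; rewrite aP.2.
Qed.

Let borel_vaught_code : borel_map vaught_code.
Proof.
apply: borel_map_bits => -[m s].
have [_ /(_ s)] := montgomery_novikov (borel_hit (recurrent_pair m)).
rewrite (_ : [set x | _] = [set x | bit (vaught_code x) (existT _ m s)]) //.
by apply/seteqP; split=> x /asboolP.
Qed.

(* [guess p y g] is the truth value of [a g x \in dball p] as forced by a finite
   part of [g], read off the code [y] of [x]. *)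
Let guess p (y : Y) (g : Sinf) := exists t, cyl t g /\
  forall w, uniq w -> prefix t w -> recurrent_pair (size w) = p -> seq_bit y w.

Let borel_guess p : borel [set q : Sinf * Y | guess p q.2 q.1].
Proof.
apply: borel_exists => t; apply: borel_and.
  apply: (@continuous_borel_map _ _ fst _ _ (borel_open (@open_cyl t))).
  by move=> x; exact: cvg_fst.
apply: borel_forall => w; apply: borel_imply; first exact: borel_const.
apply: borel_imply; first exact: borel_const.
apply: borel_imply; first exact: borel_const.
apply: (@continuous_borel_map _ _ snd _ _
  (@borel_bit L_infty (existT _ (size w) (in_tuple w)))).
by move=> x; exact: cvg_snd.
Qed.

(** A wrong guess has two causes. If t forces a false positive, g lies in the meager set U_t minus
    C, and there are countably many t. If g is in C but no t forces it, [meager_local] applies: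
    below a cylinder where C is non-meager there is one where C is comeager, and that one forces. *)
Let guessP x : meager [set g | exists p,
  ~ (guess p (vaught_code x) g <-> dball p (a g x))].
Proof.
apply: meager_exists => p; pose C := [set g | dball p (a g x)].
have bC : baire_property C := @baire_hit x p.
have forced t : uniq t -> meager (cyl t `\` C) <->
    forall w, uniq w -> prefix t w -> recurrent_pair (size w) = p ->
    seq_bit (vaught_code x) w.
  move=> ut; rewrite comeagerP //; split=> [tC w uw tw wp|tC w uw tw].
    by apply/vaught_codeE; rewrite wp; exact: tC.
  (* The length of w need not serve p, so w is extended to a length that does; non-meagerness there
     passes back to w. *)
  have [m wm mp] := recurrent_pairP p (size w).
  have [r [wr ur rm]] := uniq_extend uw wm; apply: (often_prefix wr).
  have := tC r ur (prefix_trans tw wr); rewrite rm => /(_ mp)/vaught_codeE.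
  by rewrite rm mp.
apply: (@sub_meager _ ([set g | exists t, meager (cyl t `\` C) /\ (cyl t `\` C) g] `|`
    (cyl [::] `&` [set g | C g /\ ~ guess p (vaught_code x) g]))).
  move=> g /= ng; have [Cg|Cg] := pselect (C g); [right|left].
    by split=> //; split=> // gg; apply: ng.
  have [[t [tg tP]]|gg] := pselect (guess p (vaught_code x) g); last first.
    by case: ng; split.
  by exists t; split=> //; apply/forced => //; exact: cyl_uniq tg.
apply: meagerU.
  apply: meager_exists => t; have [tC|tC] := pselect (meager (cyl t `\` C)).
    by apply: sub_meager tC => g [].
  by apply: sub_meager meager0 => g [].
apply: meager_local => t ut _.
have [tC|tC] := pselect (often t C); last first.
  exists t; split=> //; first exact: prefix_refl.
  by apply: sub_meager (contrapT tC) => g [tg [Cg _]].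
have [w [uw tw wC]] := bC t ut tC; exists w; split=> //.
apply: sub_meager meager0 => g [wg [_]]; apply; exists w; split=> //.
exact/forced.
Qed.

(** The first n for which g x is guessed to be within 1/(j+1) of [D n]. When all guesses for x and g
    are right such an n exists, by density, so the default 0 is not met. *)
Let index j (q : Sinf * Y) : nat :=
  if pselect (exists n, `[< guess (n, j) q.2 q.1 >]) is left h then ex_minn h else 0%N.

Let borel_index j n : borel [set q | index j q = n].
Proof.
rewrite (_ : mkset _ = [set q |
    (guess (n, j) q.2 q.1 /\ forall k, (k < n)%N -> ~ guess (k, j) q.2 q.1) \/
    (n = 0%N /\ forall k, ~ guess (k, j) q.2 q.1)]).
  apply: borel_or; apply: borel_and; first exact: borel_guess.
  - apply: borel_forall => k; apply: borel_imply; first exact: borel_const.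
    exact: borel_not (borel_guess _).
  - exact: borel_const.
  - by apply: borel_forall => k; exact: borel_not (borel_guess _).
apply/seteqP; split=> q /=; rewrite /index; case: pselect => [h|h].
- case: ex_minnP => m /asboolP mq mmin <-; left; split=> // k km /asboolP /mmin.
  by rewrite leqNgt km.
- by move=> <-; right; split=> // k kq; apply: h; exists k; exact/asboolP.
- case: ex_minnP => m /asboolP mq mmin [[nq nmin]|[_ /(_ m)//]].
  apply/eqP; rewrite eqn_leq mmin; last exact/asboolP.
  by rewrite leqNgt; apply/negP => /nmin.
- by move=> [[nq _]|[-> //]]; case: h; exists n; exact/asboolP.
Qed.

(** Where all guesses are right, the j-th guessed point is within 1/(j+1) of g x, so these points
    converge to it. The map z sees x only through its code. *)
Let decode : exists z : Sinf * Y -> X, borel_map z /\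
  forall x, meager [set g | z (g, vaught_code x) <> a g x].
Proof.
have [z [bz zP]] := borel_limit D x0 dP borel_index; exists z; split=> // x.
apply: sub_meager (guessP x) => g /= zg; apply: contrapT => ng.
have {ng}gP p : guess p (vaught_code x) g <-> dball p (a g x).
  by apply: contrapT => pn; apply: ng; exists p.
apply: zg; apply: zP; apply/(cvg_distP dP) => e /invS_small[m me].
exists m => j mj; apply: lt_le_trans (ltW me).
apply: lt_le_trans (_ : j.+1%:R^-1 <= _); last first.
  by rewrite lef_pV2 ?posrE ?ltr0n // ler_nat.
rewrite /index; case: pselect => [h|[]]; first by case: ex_minnP => n /asboolP/gP.
have [|n nP] := @DP (a g x) j.+1%:R^-1; first by rewrite invr_gt0 ltr0n.
by exists n; apply/asboolP/gP.
Qed.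

Lemma vaught_code_embedding : borel_embedding a (@logic_action L_infty) vaught_code.
Proof.
split; [exact: borel_vaught_code| |exact: vaught_code_act].
move=> x y xy; have [z [_ zP]] := decode.
(* Two meager sets do not cover the group, so one g decodes both codes; equal codes then give g x =
   g y. *)
have [g [_ [gx gy]]] : exists g, cyl [::] g /\
    (z (g, vaught_code x) = a g x /\ z (g, vaught_code y) = a g y).
  have := meagerU (zP x) (zP y) => mU; apply: contrapT => ng.
  apply: (@cyl_nonmeager [::] isT); apply: sub_meager mU => g _.
  by apply: contrapT => /not_orP[/contrapT gx /contrapT gy]; apply: ng; exists g.
by rewrite -(aP.1 x) -(aP.1 y) -(mulVg g) !aP.2 -gx -gy xy.
Qed.

(* [y] is the code of a point of [B] if and only if, for comeager many [g], the
   guesses made from [g] and [y] converge to a point of [B] whose code is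
   [g y]; no theorem on injective Borel images is needed. *)
Lemma vaught_code_image (B : set X) : borel B -> Defs.invariant a B ->
  borel (vaught_code @` B).
Proof.
move=> bB iB; have [z [bz zP]] := decode.
pose W := [set q : Sinf * Y |
  vaught_code (z q) = logic_action q.1 q.2 /\ B (z q)].
have bW : borel W.
  apply: borel_and; last exact: bz.
  rewrite (_ : mkset _ = [set q : Sinf * Y | forall p,
      bit (vaught_code (z q)) p <-> bit (logic_action q.1 q.2) p]).
    apply: borel_forall => p; apply: borel_iff.
      exact: (borel_map_comp bz borel_vaught_code (borel_bit p)).
    exact: (continuous_borel_map (@logic_action_continuous L_infty) (borel_bit p)).
  apply/seteqP; split=> q /= => [-> //|qP]; apply: bit_inj => p.
  by apply/idP/idP => /(qP p).
rewrite (_ : _ @` _ = [set y | ~ often [::] [set g | (~` W) (g, y)]]).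
  by apply: borel_not; have [_] := montgomery_novikov (borel_setC bW); exact.
apply/seteqP; split=> y /=.
  move=> [x Bx <-] ny; apply: ny; apply: sub_meager (zP x) => g [_ nW] zg.
  by apply: nW; rewrite /W /= zg vaught_code_act; split=> //; exact: iB.
move=> /contrapT my; have [g Wg] : exists g, W (g, y).
  apply: contrapT => ng; apply: (@cyl_nonmeager [::] isT); apply: sub_meager my.
  by move=> g _; split=> // Wg; apply: ng; exists g.
have [/= gy Bz] := Wg; exists (a g^-1%g (z (g, y))); first exact: iB.
have [la1 laM] := logic_action_is_action L_infty.
by rewrite vaught_code_act gy -laM mulVg la1.
Qed.

End VaughtEmbedding.

Lemma borel_space_embedding (R : realType) (X : topologicalType)
    (a : Sinf -> X -> X) : borel_space R a ->
  exists2 f : X -> structure L_infty, borel_embedding a (@logic_action L_infty) f &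
    forall B, borel B -> Defs.invariant a B -> borel (f @` B).
Proof.
case=> -[sX /completely_metrizableP[d dP]] aP ba.
have [[x0 _]|nX] := pselect (exists x : X, True).
  have [D DP] := dense_seq x0 dP sX; exists (vaught_code a d D).
    exact: (vaught_code_embedding x0 aP ba dP DP).
  exact: (vaught_code_image x0 aP ba dP DP).
(* The case of an empty X, where there is no [x0] to start the construction. *)
exists (fun _ _ _ => false).
  split=> [B _||] => [|x|g x]; try by case: nX; exists x.
  rewrite (_ : _ @^-1` _ = set0); first exact: borel_open open0.
  by apply/seteqP; split=> x; case: nX; exists x.
move=> B _ _; rewrite (_ : _ @` _ = set0); first exact: borel_open open0.
by apply/seteqP; split=> y // [x]; case: nX; exists x.
Qed.

(** * Perfect sets *)

Lemma sub_countableW (T : Type) (A B : set T) : A `<=` B -> countable B -> countable A.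
Proof. by move=> AB; apply: sub_countable; exact: subset_card_le. Qed.

Lemma countable_exists (T : Type) (I : countType) (P : I -> set T) :
  (forall i, countable (P i)) -> countable [set x | exists i, P i x].
Proof.
move=> cP; rewrite (_ : mkset _ = \bigcup_i P i).
  by apply: bigcup_countable => // i _; exact: cP.
by apply/seteqP; split=> x [i]; exists i.
Qed.

(** Two points at distance at least e are not both within less than e/4 of a third. *)
Lemma quarter_gap (R : realFieldType) (e a b c r : R) : e <= c -> c <= a + b ->
  a <= r -> b <= r -> r < e / 2 / 2 -> 0 < e -> False.
Proof. by move=> *; lra. Qed.

Section PerfectSets.
Variables (R : realType) (X : topologicalType) (d : X -> X -> R).
Hypothesis dP : complete_metric d.
Implicit Types (A P : set X).

Lemma closed_dist A : closed A <->
  forall x, (forall e : R, 0 < e -> exists2 y, d x y < e & A y) -> A x.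
Proof.
split=> [cA x xA|Acl].
  apply: cA => B /(nbhs_ballP dP)[e e0 eB]; have [y xy Ay] := xA e e0.
  by exists y; split=> //; exact: eB.
move=> x clx; apply: Acl => e e0.
by have [y [Ay xy]] := clx _ (nbhs_dball dP x e0); exists y.
Qed.

Lemma hausdorff_dist : hausdorff_space X.
Proof.
move=> x y xy; apply: contrapT => /(dist_gt0 dP) d0.
have d2 : 0 < d x y / 2 by rewrite divr_gt0.
have [z [/= xz yz]] := xy _ _ (nbhs_dball dP x d2) (nbhs_dball dP y d2).
have := dist_tri dP x z y; rewrite leNgt => /negP; apply.
by rewrite [ltRHS]splitr ltrD // (distC dP).
Qed.

Lemma limit_point_dist P : closed P ->
  (forall x (e : R), P x -> 0 < e -> exists y, [/\ P y, x <> y & d x y < e]) ->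
  perfect_set P.
Proof.
move=> cP iP; split=> //; apply/seteqP; split=> x.
  by move=> /subset_limit_point; exact: cP.
move=> Px U /(nbhs_ballP dP)[e e0 eU]; have [y [Py xy xye]] := iP x e Px e0.
by exists y; split=> //; [apply/eqP => yx; apply: xy|exact: eU].
Qed.

(** Nested balls: stage n keeps its closed ball away from the point that f numbers n, if any. The
    limit of the centres lies in P and contradicts the stage given by its own number. *)
Lemma perfect_uncountable P : P !=set0 -> perfect_set P -> ~ countable P.
Proof.
move=> [p0 Pp0] [cP lP] /countable_injP[f finj].
have {}finj x y : P x -> P y -> f x = f y -> x = y.
  by move=> Px Py; apply: finj; rewrite inE.
have /choice[next nextP] : forall q : nat * (X * R), exists q' : X * R,
    P q.2.1 -> 0 < q.2.2 ->
    [/\ P q'.1, 0 < q'.2, d q.2.1 q'.1 + q'.2 <= q.2.2, q'.2 < q.1.+1%:R^-1 &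
     forall u, P u -> f u = q.1 -> q'.2 < d q'.1 u].
  case=> n [x r] /=; have [[Px r0]|nP] := pselect (P x /\ 0 < r); last first.
    by exists (x, r) => ? ?; case: nP.
  have [x' [Px' xx' fx']] : exists x', [/\ P x', d x x' < r & f x' <> n].
    have [fx|fx] := pselect (f x = n); last by exists x; rewrite distxx.
    have : limit_point P x by rewrite lP.
    move=> /(_ _ (nbhs_dball dP x r0))[y [/eqP yx Py xy]].
    by exists y; split=> // fy; apply: yx; apply: finj => //; rewrite fy.
  have [e e0 eP] : exists2 e : R, 0 < e & forall u, P u -> f u = n -> e < d x' u.
    have [[u [Pu fu]]|nu] := pselect (exists u, P u /\ f u = n); last first.
      by exists 1 => // u Pu fu; case: nu; exists u.
    have ux : 0 < d x' u by apply: (dist_gt0 dP) => xu; apply: fx'; rewrite xu.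
    exists (d x' u / 2); first by rewrite divr_gt0.
    move=> v Pv fv; rewrite (_ : v = u); last by apply: finj; rewrite // fv.
    by rewrite ltr_pdivrMr // ltr_pMr // ltr1n.
  have n0 : 0 < n.+1%:R^-1 :> R by rewrite invr_gt0 ltr0n.
  (* The three bounds keep the new ball inside the old one, keep it off the point numbered n, and
     make the radii tend to 0. *)
  pose s := Num.min (Num.min (r - d x x') e) (n.+1%:R^-1 / 2).
  have s0 : 0 < s by rewrite !lt_min e0 subr_gt0 xx' divr_gt0.
  exists (x', s) => _ _ /=; split=> //.
  - by rewrite -lerBrDl !ge_min lexx.
  - apply: le_lt_trans (_ : n.+1%:R^-1 / 2 < _); first by rewrite ge_min lexx orbT.
    by rewrite ltr_pdivrMr // ltr_pMr // ltr1n.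
  - move=> u Pu fu; apply: le_lt_trans (eP u Pu fu).
    by rewrite !ge_min lexx orbT.
pose S := fix S n := if n is m.+1 then next (m, S m) else (p0, 1 : R).
have SP n : P (S n).1 /\ 0 < (S n).2.
  by elim: n => //= n [Pn n0]; have [] := nextP (n, S n) Pn n0.
have Snext n := nextP (n, S n) (SP n).1 (SP n).2.
have Sle n k : d (S n).1 (S (n + k)%N).1 + (S (n + k)%N).2 <= (S n).2.
  elim: k => [|k IH]; first by rewrite addn0 distxx // add0r.
  rewrite addnS; apply: le_trans IH; have [_ _ nk _ _] := Snext (n + k)%N.
  apply: le_trans (lerD (lexx _) nk); rewrite addrA lerD2r.
  exact: dist_tri.
have Slt n m : (n <= m)%N -> d (S n).1 (S m).1 <= (S n).2.
  move=> /subnKC <-; apply: le_trans (Sle n (m - n)%N).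
  by rewrite lerDl ltW // (SP _).2.
have [|x xS] := @dist_complete _ _ _ dP (fun n => (S n).1).
  move=> e e0; have e2 : 0 < e / 2 by rewrite divr_gt0.
  have [n ne] := invS_small e2; exists n.+1 => j k nj nk.
  have Sn : (S n.+1).2 < e / 2 by apply: lt_trans ne; have [] := Snext n.
  apply: le_lt_trans (dist_tri dP _ (S n.+1).1 _) _; rewrite [ltRHS]splitr.
  by rewrite ltrD //; [rewrite (distC dP)|]; apply: le_lt_trans Sn; exact: Slt.
have {}xS := (cvg_distP dP _ _).1 xS.
have Px : P x.
  apply: (closed_dist P).1 cP _ _ => e e0; have [N NP] := xS e e0.
  by exists (S N).1; [rewrite (distC dP); exact: NP|exact: (SP N).1].
have [_ _ _ _ /(_ x Px erefl)] := Snext (f x).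
rewrite -[next _]/(S (f x).+1) -subr_gt0 => gap.
have [N NP] := xS _ gap; set M := maxn N (f x).+1.
have := NP M (leq_maxl _ _); rewrite ltrBrDl ltNge => /negP; apply.
apply: le_trans (dist_tri dP _ (S M).1 _) _; rewrite lerD2r.
exact: Slt (leq_maxr _ _).
Qed.

(** * The perfect set theorem for Borel sets *)

(** F is closed in the product of X with the Baire space. *)
Definition closed_rel (F : X -> (nat -> nat) -> Prop) := forall x w,
  (forall (e : R) n, 0 < e -> exists y v,
    [/\ d x y < e, forall i, (i < n)%N -> v i = w i & F y v]) -> F x w.

(** The analytic sets, as projections of closed sets. *)
Definition souslin A := exists F, closed_rel F /\
  forall x, A x <-> exists w, F x w.

Lemma souslin_closed A : closed A -> souslin A.
Proof.
move=> /closed_dist cA; exists (fun x _ => A x); split=> [x w xw|x].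
  by apply: cA => e e0; have [y [v [xy _ Ay]]] := xw e 0%N e0; exists y.
by split=> [Ax|[]//]; exists id.
Qed.

Lemma souslin_bigcup (A : nat -> set X) :
  (forall n, souslin (A n)) -> souslin (\bigcup_n A n).
Proof.
move=> /choice[F FP]; have cF n := (FP n).1; have FA n := (FP n).2.
exists (fun x w => F (w 0%N) x (fun k => w k.+1)); split=> [x w xw|x].
  apply: cF => e n e0; have [y [v [xy vw Fy]]] := xw e n.+1 e0.
  exists y, (fun k => v k.+1); split=> // [i ni|]; first exact: vw.
  by rewrite -(vw 0%N).
split=> [[n _ /FA[w Fw]]|[w Fw]]; last first.
  by exists (w 0%N) => //; apply/FA; exists (fun k => w k.+1).
by exists (fun k => if k is j.+1 then w j else n).
Qed.

Lemma souslin_bigcap (A : nat -> set X) :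
  (forall n, souslin (A n)) -> souslin (\bigcap_n A n).
Proof.
move=> /choice[F FP]; have cF n := (FP n).1; have FA n := (FP n).2.
exists (fun x w => forall n, F n x (fun k => w (pickle (n, k)))); split=> [x w xw n|x].
  apply: cF => e m e0.
  (* The bound covers the codes of (n, k) for all k < m, so that v and w agree on the first m
     entries of row n. *)
  have [y [v [xy vw Fy]]] := xw e (\max_(k < m) (pickle (n, k : nat)).+1)%N e0.
  exists y, (fun k => v (pickle (n, k))); split=> // k km; apply: vw.
  exact: (leq_bigmax (Ordinal km)).
split=> [Ax|[w Fw] n _]; last by apply/FA; exists (fun k => w (pickle (n, k))).
have /choice[w wP] n : exists w, F n x w by apply/FA; exact: Ax.
exists (fun m => if unpickle m is Some (n, k) then w n k else 0%N) => n.
rewrite (_ : (fun k => _) = w n) //; apply/funext => k; by rewrite pickleK.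
Qed.

Lemma souslin_open A : open A -> souslin A.
Proof.
move=> oA; rewrite (_ : A = \bigcup_n [set x | forall y, d x y < n.+1%:R^-1 -> A y]).
  apply: souslin_bigcup => n; apply: souslin_closed; apply/closed_dist => x xA y xy.
  have [z xz] := xA (n.+1%:R^-1 - d x y) ltac:(by rewrite subr_gt0).
  apply; apply: le_lt_trans (dist_tri dP z x y) _.
  by rewrite -ltrBrDr (distC dP).
apply/seteqP; split=> x.
  move=> Ax; have /(nbhs_ballP dP)[e e0 eA] : nbhs x A by exact: open_nbhs_nbhs.
  by have [n ne] := invS_small e0; exists n => // y xy; apply: eA; exact: lt_trans ne.
by move=> [n _]; apply; rewrite distxx // invr_gt0 ltr0n.
Qed.

(** The induction treats a set together with its complement, since analytic sets are not closed
    under complements. *)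
Lemma borel_souslin A : borel A -> souslin A.
Proof.
move=> bA; suff [] : souslin A /\ souslin (~` A) by [].
move: A bA; apply: borel_ind.
- by move=> A oA; split; [exact: souslin_open|apply: souslin_closed; exact: open_closedC].
- by move=> A [? ?]; rewrite setCK.
- move=> F sF; split; first by apply: souslin_bigcup => n; case: (sF n).
  by rewrite setC_bigcup; apply: souslin_bigcap => n; case: (sF n).
Qed.

Section PerfectSubset.
Variables (D : nat -> X) (F : X -> (nat -> nat) -> Prop).
Hypothesis DP : forall x (e : R), 0 < e -> exists n, d (D n) x < e.
Hypothesis cF : closed_rel F.

(** The balls of a countable base that meet A in a countable set together remove only countably many
    points of A; any two of the remaining points will do. *)
Lemma condensation_points A : ~ countable A -> exists x y, x <> y /\
  forall (e : R), 0 < e -> ~ countable (A `&` [set z | d x z < e]) /\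
    ~ countable (A `&` [set z | d y z < e]).
Proof.
move=> nA.
pose B (p : nat * nat) := A `&` [set z | d (D p.1) z < p.2.+1%:R^-1].
pose C := [set x | exists p, (countable (B p) /\ B p x)].
have cC : countable C.
  apply: countable_exists => p; have [cB|cB] := pselect (countable (B p)).
    by apply: sub_countableW cB => x [].
  by apply: sub_countableW (countable0 X) => x [].
have AC x e : (A `\` C) x -> 0 < e -> ~ countable (A `&` [set z | d x z < e]).
  move=> [Ax nC] e0 cA; have e2 : 0 < e / 2 by rewrite divr_gt0.
  have [m me] := invS_small e2; have [|n nx] := @DP x m.+1%:R^-1.
    by rewrite invr_gt0 ltr0n.
  apply: nC; exists (n, m); split=> //; apply: sub_countableW cA => z [Az /= nz].
  split=> //=; apply: le_lt_trans (dist_tri dP _ (D n) _) _.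
  rewrite [ltRHS]splitr ltrD //; last exact: lt_trans me.
  by rewrite (distC dP); exact: lt_trans me.
have [x Ax] : (A `\` C) !=set0.
  apply: contrapT => n; apply: nA; apply: sub_countableW cC => z Az.
  by apply: contrapT => nC; apply: n; exists z.
have [y [Ay xy]] : exists y, (A `\` C) y /\ x <> y.
  apply: contrapT => n; apply: nA.
  apply: (@sub_countableW _ _ (C `|` [set x])).
    move=> z Az; have [Cz|nC] := pselect (C z); [by left|right].
    by apply: contrapT => zx; apply: n; exists z; split=> // xz; apply: zx.
  rewrite -bigcup2E; apply: bigcup_countable => // -[|[|k]] _ //=.
by exists x, y; split=> // e e0; split; exact: AC.
Qed.

Let extends (w : nat -> nat) (s : seq nat) :=
  forall i, (i < size s)%N -> w i = nth 0%N s i.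

Let node := (set X * seq nat)%type.

(** The prefix [N.2] commits the points of [N.1] to a common beginning of their witnesses, so that
    witnesses converge along a branch together with the points. *)
Let good (N : node) := ~ countable N.1 /\
  forall y, N.1 y -> exists w, extends w N.2 /\ F y w.

Let child n (N M : node) := [/\ good M, M.1 `<=` N.1, exists k, M.2 = rcons N.2 k &
  forall y z, M.1 y -> M.1 z -> d y z < n.+1%:R^-1].

(** Sorting the points in the ball by the next value k of a witness gives countably many pieces, of
    which one is uncountable. *)
Let good_ball N x e n : good N -> e <= n.+1%:R^-1 / 2 ->
  ~ countable (N.1 `&` [set z | d x z < e]) ->
  exists2 M, child n N M & M.1 `<=` [set z | d x z < e].
Proof.
case: N => E s [/= nE EF] en nEe.
pose E' k := [set z | [/\ E z, d x z < e & exists w, extends w (rcons s k) /\ F z w]].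
have [k nk] : exists k, ~ countable (E' k).
  apply: contrapT => n'; apply: nEe.
  apply: (@sub_countableW _ _ [set z | exists k, E' k z]).
    move=> z [Ez xz]; have [w [ws Fw]] := EF z Ez; exists (w (size s)).
    split=> //; exists w; split=> // i; rewrite size_rcons ltnS nth_rcons leq_eqVlt.
    by case/predU1P => [->|si]; rewrite ?ltnn ?eqxx // si ws.
  by apply: countable_exists => k; apply: contrapT => nk; apply: n'; exists k.
exists (E' k, rcons s k); last by move=> z [].
split=> //=; [by split=> // y [] | by move=> z [] | by exists k |].
move=> y z [_ xy _] [_ xz _]; apply: le_lt_trans (dist_tri dP y x z) _.
by rewrite [ltRHS]splitr ltrD // ?(distC dP y); exact: lt_le_trans en.
Qed.

Let split_node n N : good N -> exists M : node * node,
  [/\ child n N M.1, child n N M.2 & exists2 e : R, 0 < e &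
    forall y z, M.1.1 y -> M.2.1 z -> e <= d y z].
Proof.
move=> gN; have [x [y [xy xyP]]] := condensation_points gN.1.
have d0 := dist_gt0 dP xy; have n0 : 0 < n.+1%:R^-1 :> R by rewrite invr_gt0 ltr0n.
(* Balls of radius d(x,y)/4 about x and y leave a gap of d(x,y)/2; the other bound controls the
   diameters of the children. *)
pose e := Num.min (d x y / 4) (n.+1%:R^-1 / 2).
have e0 : 0 < e by rewrite lt_min !divr_gt0.
have en : e <= n.+1%:R^-1 / 2 by rewrite ge_min lexx orbT.
have [nx ny] := xyP e e0.
have [M1 c1 M1x] := good_ball gN en nx; have [M2 c2 M2y] := good_ball gN en ny.
exists (M1, M2); split=> //; exists (d x y / 2); first by rewrite divr_gt0.
move=> u v /M1x /= xu /M2y /= yv.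
have ed : e <= d x y / 4 by rewrite ge_min lexx.
have := dist_tri dP x u y; have := dist_tri dP u v y; rewrite (distC dP v y).
by move: (d u y) (d x u) (d y v) (d u v) xu yv => *; lra.
Qed.

(** A Cantor scheme whose sets need not be closed, so a limit [x u] may leave the sets of its own
    branch. Closedness of F puts it into the projection, and the positive gap between siblings, not
    their mere disjointness, keeps distinct limits apart. *)
Lemma uncountable_has_perfect : ~ countable [set x | exists w, F x w] ->
  exists P, [/\ P !=set0, perfect_set P & P `<=` [set x | exists w, F x w]].
Proof.
move=> nA.
have /choice[f fP] : forall q : nat * node, exists M : node * node, good q.2 ->
    [/\ child q.1 q.2 M.1, child q.1 q.2 M.2 & exists2 e : R, 0 < e &
    forall y z, M.1.1 y -> M.2.1 z -> e <= d y z].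
  case=> n N; have [gN|gN] := pselect (good N).
    by have [M MP] := split_node n gN; exists M.
  by exists (N, N).
pose pick (b : bool) (M : node * node) := if b then M.1 else M.2.
pose T (u : nat -> bool) := fix T n := if n is m.+1 then pick (u m) (f (m, T m))
  else ([set x | exists w, F x w], [::]) : node.
have Tgood u n : good (T u n).
  elim: n => [|n gn] /=; first by split=> // y [w Fw]; exists w.
  by rewrite /pick; have [[? _ _ _] [? _ _ _] _] := fP (n, T u n) gn; case: (u n).
have Tchild u n : child n (T u n) (T u n.+1).
  by have [? ? _] := fP (n, T u n) (Tgood u n); rewrite /= /pick; case: (u n).
have Tsub u m n : (m <= n)%N -> (T u n).1 `<=` (T u m).1.
  elim: n => [|n IH]; first by rewrite leqn0 => /eqP ->.
  rewrite leq_eqVlt => /predU1P[->//|/IH]; apply: subset_trans.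
  by case: (Tchild u n).
have Tagree u v n : (forall i, (i < n)%N -> u i = v i) -> T u n = T v n.
  elim: n => //= n IH uv; rewrite uv // IH // => i ni.
  by apply: uv; exact: ltnW.
have Tpoint u n : exists x, (T u n).1 x.
  apply: contrapT => nx; apply: (Tgood u n).1; apply: sub_countableW (countable0 X).
  by move=> x xT; apply: nx; exists x.
have /choice[x0 x0P] := fun p : (nat -> bool) * nat => Tpoint p.1 p.2.
have /choice[x xP] u : exists x, forall n y, (T u n.+1).1 y -> d x y <= n.+1%:R^-1.
  have Tdiam n y z : (T u n.+1).1 y -> (T u n.+1).1 z -> d y z < n.+1%:R^-1.
    by case: (Tchild u n) => _ _ _; exact.
  have [|x xu] := @dist_complete _ _ _ dP (fun n => x0 (u, n)).
    move=> e /invS_small[n ne]; exists n.+1 => j k nj nk; apply: lt_trans ne.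
    apply: Tdiam; [apply: (Tsub _ _ _ nj)|apply: (Tsub _ _ _ nk)].
      exact: (x0P (u, j)).
    exact: (x0P (u, k)).
  exists x => n y yT; apply/ler_addgt0Pr => e e0.
  have [N NP] := (cvg_distP dP _ _).1 xu e e0; set M := maxn N n.+1.
  apply: le_trans (dist_tri dP _ (x0 (u, M)) _) _; rewrite addrC lerD //.
    apply/ltW/Tdiam => //; apply: (Tsub _ _ M); first exact: leq_maxr.
    exact: (x0P (u, M)).
  by rewrite (distC dP); apply/ltW/NP; exact: leq_maxl.
pose w u i := nth 0%N (T u i.+1).2 i.
have Tprefix u n : prefix (T u n).2 (T u n.+1).2.
  by have [_ _ [k ->] _] := Tchild u n; exact: prefix_rcons.
have Tsize u n : size (T u n).2 = n.
  by elim: n => // n IH; have [_ _ [k ->] _] := Tchild u n; rewrite size_rcons IH.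
have Tw u n i : (i < n)%N -> nth 0%N (T u n).2 i = w u i.
  elim: n => // n IH; rewrite ltnS leq_eqVlt => /predU1P[->//|ni].
  by rewrite -IH // (nth_prefix (Tprefix u n)) ?Tsize.
have Fxw u : F (x u) (w u).
  apply: cF => e n /invS_small[m me]; set M := maxn m n.
  have [y yT] := Tpoint u M.+1; have [v [vT Fv]] := (Tgood u M.+1).2 y yT.
  exists y, v; split=> // [|i ni].
    apply: le_lt_trans me; apply: le_trans (xP u M y yT) _.
    by rewrite lef_pV2 ?posrE ?ltr0n // ler_nat ltnS leq_maxl.
  have iM : (i < M.+1)%N by rewrite ltnS (leq_trans (ltnW ni)) // leq_maxr.
  by rewrite vT ?Tsize // Tw.
have xclose u v n : (forall i, (i < n.+1)%N -> u i = v i) ->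
    d (x u) (x v) <= n.+1%:R^-1 + n.+1%:R^-1.
  move=> uv; have [y yT] := Tpoint u n.+1.
  apply: le_trans (dist_tri dP _ y _) _; rewrite lerD ?xP // (distC dP) xP //.
  by rewrite -(Tagree u v).
have xsmall (e : R) : 0 < e -> exists n, forall u v,
    (forall i, (i < n.+1)%N -> u i = v i) -> d (x u) (x v) < e.
  move=> e0; have e2 : 0 < e / 2 by rewrite divr_gt0.
  have [n ne] := invS_small e2; exists n => u v /xclose uv.
  by apply: le_lt_trans uv _; rewrite [ltRHS]splitr ltrD.
have xsep (u v : nat -> bool) n : (forall i, (i < n)%N -> u i = v i) ->
    u n -> ~~ v n -> x u <> x v.
  move=> uv un vn xuv; have [_ _ [e e0 eP]] := fP (n, T u n) (Tgood u n).
  have e2 : 0 < e / 2 / 2 by rewrite !divr_gt0.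
  have [m me] := invS_small e2; set M := maxn m n.
  have [y yT] := Tpoint u M.+1; have [z zT] := Tpoint v M.+1.
  have Me : M.+1%:R^-1 < e / 2 / 2.
    by apply: le_lt_trans me; rewrite lef_pV2 ?posrE ?ltr0n // ler_nat ltnS leq_maxl.
  have nM : (n.+1 <= M.+1)%N by rewrite ltnS leq_maxr.
  have := Tsub u _ _ nM y yT; have := Tsub v _ _ nM z zT.
  rewrite /= /pick un (negbTE vn) -(Tagree u v n uv) => zn yn.
  have := eP y z yn zn; have := dist_tri dP y (x u) z.
  have := xP u M y yT; have := xP v M z zT; rewrite -xuv (distC dP y (x u)) => zr yr tri far.
  exact: quarter_gap far tri yr zr Me e0.
exists [set x u | u in setT]; split.
- by exists (x xpred0), xpred0.
- apply: limit_point_dist.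
    (* The limits form a continuous image of the compact Cantor space, hence a closed set. *)
    have xcont : continuous (x : cantor_space -> X).
      move=> u A /(nbhs_ballP dP)[e /xsmall[n ne] eA].
      suff : nbhs u [set v : cantor_space | forall i, (i < n.+1)%N -> u i = v i].
        by apply: filterS => v uv; apply: eA; exact: ne.
      elim: n.+1 => [|k IH]; first by apply: (filterS _ filterT).
      have : nbhs u [set v : cantor_space | v k = u k].
        apply: (@proj_continuous nat (fun=> bool) k u [set b | b = u k]).
        by rewrite nbhs_principalE; apply/principal_filterP.
      apply: filterS2 IH => v uv vk i; rewrite ltnS leq_eqVlt => /predU1P[->//|].
      exact: uv.
    apply: (compact_closed hausdorff_dist).
    apply: (@continuous_compact cantor_space X x setT).
      by apply: continuous_subspaceT; exact: xcont.
    exact: cantor_space_compact.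
  move=> _ e [u _ <-] /xsmall[n ne].
  (* Agreeing with u up to n makes [x v] close to [x u]; the flip at n+1 makes it different. *)
  pose v i := if (i < n.+1)%N then u i else ~~ u i.
  have uv i : (i < n.+1)%N -> u i = v i by move=> ni; rewrite /v ni.
  exists (x v); split; [by exists v| |exact: ne].
  have vn : v n.+1 = ~~ u n.+1 by rewrite /v ltnn.
  have [un|un] := boolP (u n.+1); first by apply: (xsep u v n.+1); rewrite ?vn ?un.
  by apply/nesym/(xsep v u n.+1) => [i /uv //|//|//]; rewrite vn.
- by move=> _ [u _ <-]; exists (w u).
Qed.

End PerfectSubset.
End PerfectSets.

Lemma borel_has_perfect (R : realType) (X : topologicalType) (A : set X) :
  polish R X -> borel A -> ~ countable A ->
  exists P, [/\ P !=set0, perfect_set P & P `<=` A].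
Proof.
move=> [sX /completely_metrizableP[d dP]] bA nA.
have [x0 _] : A !=set0.
  apply: contrapT => n; apply: nA; apply: sub_countableW (countable0 X) => x Ax.
  by apply: n; exists x.
have [D DP] := dense_seq x0 dP sX; have [F [cF FA]] := borel_souslin dP bA.
have AE : A = [set x | exists w, F x w] by apply/seteqP; split=> x /FA.
by rewrite AE; apply: (uncountable_has_perfect dP DP cF); rewrite -AE.
Qed.

Lemma polish_perfect_uncountable (R : realType) (X : topologicalType) (P : set X) :
  polish R X -> P !=set0 -> perfect_set P -> ~ countable P.
Proof. by move=> [_ /completely_metrizableP[d dP]]; exact: perfect_uncountable dP P. Qed.

Lemma countable_inj_image (T U : Type) (f : T -> U) (A : set T) :
  injective f -> countable (f @` A) -> countable A.
Proof.
move=> fI /countable_injP[g gI]; apply/countable_injP; exists (g \o f) => x y.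
rewrite !inE => Ax Ay /= /gI fxy; apply: fI; apply: fxy; rewrite inE.
  by exists x.
by exists y.
Qed.

(** * Initial topologies of bits, and satisfaction under the action *)

Lemma initial_bits (S : choiceType) (I : countType) (c : S -> {ptws I -> bool}) :
  bit_topology (c : initial_topology c -> I -> bool).
Proof.
move=> x A; split=> [|[F FA]]; last first.
  suff : nbhs x [set y : initial_topology c | {in F, c y =1 c x}] by exact: filterS.
  elim: F {FA} => [|i F IH]; first by apply: (filterS _ filterT).
  have ci : nbhs x [set y : initial_topology c | c y i = c x i].
    have cv : continuous (fun y : initial_topology c => c y i).
      move=> y; apply: (@continuous_comp (initial_topology c) {ptws I -> bool} bool c (@^~ i)).
        exact: initial_continuous.
      exact: (@proj_continuous I (fun=> bool) i).
    apply: (cv x [set b | b = c x i]).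
    by rewrite nbhs_principalE; apply/principal_filterP.
  by apply: filterS2 ci IH => y yi yF j; rewrite inE => /predU1P[->|/yF].
pose G : set_system (initial_topology c) :=
  filter_from setT (fun F : seq I => [set y | {in F, c y =1 c x}]).
have GF : Filter G.
  apply: filter_from_filter; first by exists [::].
  move=> F F' _ _; exists (F ++ F') => // y yFF'.
  by split=> i iF; apply: yFF'; rewrite mem_cat iF ?orbT.
suff Gx : G A -> exists F : seq I, forall y, {in F, c y =1 c x} -> A y.
  move=> [_ [[B oB <-] Bx] BA]; apply: Gx; apply: filterS BA _.
  suff Gcx : c @ G --> c x by apply: Gcx; exact: open_nbhs_nbhs.
  apply/cvg_sup => i C [_ [[D oD <-] Dx] DC].
  exists [:: i] => // y yx; apply: DC => /=.
  by have -> : c y i = c x i by apply: yx; rewrite inE.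
by move=> [F _ FA]; exists F.
Qed.

Lemma sat_act (L : language) g (x : structure L) n (phi : formula L n)
    (v : n.-tuple nat) :
  sat (logic_action g x) phi v <-> sat x phi (map_tuple (g^-1 : Sinf)%g v).
Proof.
elim: n / phi v => [n j k|n i t|n phi IH|n phi IH|n phi IH|n phi IH|n phi IH] v /=.
- by rewrite !tnth_map; split=> [-> //|]; exact: Sinf_inj.
- rewrite /logic_action.
  suff -> : map_tuple (g^-1 : Sinf)%g (map_tuple (tnth v) t) =
    map_tuple (tnth (map_tuple (g^-1 : Sinf)%g v)) t by [].
  by apply: eq_from_tnth => j; rewrite !tnth_map.
- by rewrite IH.
- by split=> xP k; apply/IH.
- by split=> -[k /IH]; exists k.
- split=> xP b; last first.
    apply/IH; have := xP ((g^-1 : Sinf)%g b).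
    by congr (sat _ _ _); apply: val_inj.
  have /IH := xP (g b); congr (sat _ _ _); apply: val_inj.
  by rewrite /= Sinf_KV.
- split=> -[b].
    move=> /IH xb; exists ((g^-1 : Sinf)%g b); move: xb.
    by congr (sat _ _ _); apply: val_inj.
  move=> xb; exists (g b); apply/IH; move: xb; congr (sat _ _ _); apply: val_inj.
  by rewrite /= Sinf_KV.
Qed.

(** * The topology of the truth values of subformulas *)

Section Subformulas.
Variable L : language.

Definition some_formula := {n : nat & formula L n}.

(** Constructors with one immediate subformula ignore k and atomic formulas are their own children,
    so every list of numbers is the address of a subformula. *)
Definition child (psi : some_formula) (k : nat) : some_formula :=
  match projT2 psi with
  | Equal _ _ _ | Rel _ _ _ => psi
  | Not n f | Exists n f | Forall n f => existT _ _ f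
  | And n f | Or n f => existT _ n (f k)
  end.

(** Assignments are plain sequences, false at the wrong length, so that one index type serves
    formulas with any number of free variables. *)
Definition truth (x : structure L) (psi : some_formula) (v : seq nat) : Prop :=
  exists2 u : (projT1 psi).-tuple nat, tval u = v & sat x (projT2 psi) u.

(** One step of Tarski's definition. The truth values C of the children are a parameter, so it
    applies to satisfaction and to arbitrary bits alike. The length of v is tested only where the
    children do not enforce it. *)
Definition clause (b : bit_index L -> bool) (C : nat -> seq nat -> Prop)
    (psi : some_formula) (v : seq nat) : Prop :=
  match projT2 psi with
  | Equal n j k => size v = n /\ nth 0%N v j = nth 0%N v k
  | Rel n i t => size v = n /\
      b (existT _ i (map_tuple (fun j : 'I_n => nth 0%N v j) t))
  | Not n _ => size v = n /\ ~ C 0%N v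
  | And _ _ => forall k, C k v
  | Or _ _ => exists k, C k v
  | Forall _ _ => forall m, C 0%N (m :: v)
  | Exists _ _ => exists m, C 0%N (m :: v)
  end.

Lemma truth_size x n (f : formula L n) v : truth x (existT _ n f) v -> size v = n.
Proof. by move=> [u <- _]; rewrite size_tuple. Qed.

Lemma truth_tuple x n (f : formula L n) (v : n.-tuple nat) :
  truth x (existT _ n f) v <-> sat x f v.
Proof. by split=> [[u /val_inj -> //]|xv]; exists v. Qed.

Lemma seq_tuple (v : seq nat) n : size v = n -> exists u : n.-tuple nat, v = u.
Proof. by move=> <-; exists (in_tuple v). Qed.

Lemma truth_clause x psi v :
  truth x psi v <-> clause (bit x) (fun k w => truth x (child psi k) w) psi v.
Proof.
case: psi => n f; have [vn|vn] := eqVneq (size v) n; last first.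
  split=> [/truth_size/eqP|]; first by rewrite (negbTE vn).
  case: f vn => {}n => [j k|i t|f|f|f|f|f] /eqP vn; rewrite /clause /child /=.
  - by case.
  - by case.
  - by case.
  - by move=> /(_ 0%N)/truth_size.
  - by case=> k /truth_size.
  - by move=> /(_ 0%N)/truth_size => -[].
  - by case=> k /truth_size => -[].
have [u ->] := seq_tuple vn; rewrite truth_tuple {v vn}.
case: f u => {}n => [j k|i t|f|f|f|f|f] u; rewrite /clause /child /= ?size_tuple.
- by rewrite !(tnth_nth 0%N); split=> [|[]].
- rewrite /bit /=.
  suff -> : map_tuple (fun j : 'I_n => nth 0%N u j) t = map_tuple (tnth u) t.
    by split=> [|[]].
  by apply: eq_from_tnth => j; rewrite !tnth_map (tnth_nth 0%N).
- by rewrite truth_tuple; split=> [|[]].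
- by split=> xu k; apply/truth_tuple.
- by split=> -[k /truth_tuple]; exists k.
- by split=> xu m; have := xu m; rewrite -(truth_tuple x f [tuple of m :: u]).
- by split=> -[m xm]; exists m; apply/(truth_tuple x f [tuple of m :: u]).
Qed.

Lemma truth_act g x psi v : truth (logic_action g x) psi v <->
  truth x psi (map (g^-1 : Sinf)%g v).
Proof.
case: psi => n f; have [vn|vn] := eqVneq (size v) n.
  have [u ->] := seq_tuple vn; rewrite truth_tuple sat_act -truth_tuple.
  by [].
by split=> /truth_size; rewrite ?size_map => /eqP; rewrite (negbTE vn).
Qed.

Lemma borel_truth psi v : borel [set x | truth x psi v].
Proof.
rewrite (_ : mkset _ = [set x | exists u : (projT1 psi).-tuple nat,
    tval u = v /\ sat x (projT2 psi) u]).
  by apply: borel_exists => u; apply: borel_and; [exact: borel_const|exact: borel_sat].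
by apply/seteqP; split=> x [u]; [exists u|move=> []; exists u].
Qed.

Variable phi : sentence L.

Definition subformula (p : seq nat) : some_formula :=
  foldl child (existT _ 0%N phi) p.

Lemma subformula_rcons p k : subformula (rcons p k) = child (subformula p) k.
Proof. by rewrite /subformula foldl_rcons. Qed.

Definition truth_index : countType := (bit_index L + seq nat * seq nat)%type.

(** The empty address is that of [phi] itself: coherent bits are those of a model of [phi] together
    with the truth values of all subformulas. *)
Definition coherent (b : truth_index -> bool) : Prop :=
  b (inr ([::], [::])) /\ forall q : seq nat * seq nat, b (inr q) <->
    clause (fun i => b (inl i)) (fun k w => b (inr (rcons q.1 k, w)))
      (subformula q.1) q.2.

(** With the truth values of subformulas recorded as bits, each clause contains at most one
    quantifier over bits, however deep [phi] is; hence a G_delta set. *)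
Lemma pi02_coherent : pi02 coherent.
Proof.
apply: pi02_and; first exact/pi02_finsupp/finsupp_bit.
apply: pi02_forall => -[p v] /=; rewrite /clause.
case: (subformula p) => n [] {}n => [j k|i t|f|f|f|f|f] /=.
- by apply/pi02_finsupp/finsupp_iff; [exact: finsupp_bit|exact: finsupp_const].
- apply/pi02_finsupp/finsupp_iff; first exact: finsupp_bit.
  by apply: finsupp_and; [exact: finsupp_const|exact: finsupp_bit].
- apply/pi02_finsupp/finsupp_iff; first exact: finsupp_bit.
  apply: finsupp_and; first exact: finsupp_const.
  by apply: finsupp_imply; [exact: finsupp_bit|exact: finsupp_const].
- exact: (@pi02_iff_forall truth_index _ (fun k : nat => inr (rcons p k, v))).
- exact: (@pi02_iff_exists truth_index _ (fun k : nat => inr (rcons p k, v))).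
- exact: (@pi02_iff_forall truth_index _ (fun m : nat => inr (rcons p 0%N, m :: v))).
- exact: (@pi02_iff_exists truth_index _ (fun m : nat => inr (rcons p 0%N, m :: v))).
Qed.

Lemma coherent_truth b x : (forall i, b (inl i) = bit x i) -> coherent b ->
  forall p v, b (inr (p, v)) <-> truth x (subformula p) v.
Proof.
move=> bx [_ bP] p.
have {bP} bP (q v : seq nat) : b (inr (q, v)) <->
    clause (bit x) (fun k w => b (inr (rcons q k, w))) (subformula q) v.
  by rewrite (bP (q, v)) (funext bx).
(* The induction is on the formula, with its address generalized: addresses grow as formulas
   shrink. *)
suff main n (f : formula L n) : forall q, subformula q = existT _ n f ->
    forall v, b (inr (q, v)) <-> truth x (existT _ n f) v.
  by move=> v; case: (subformula p) (main _ (projT2 (subformula p)) p) => n f; exact.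
elim: n / f => [n j k|n i t|n f IH|n f IH|n f IH|n f IH|n f IH] q qE v;
  rewrite bP truth_clause qE /clause /child //=;
  have sE k := etrans (subformula_rcons q k) (congr1 (child^~ k) qE).
- by have E := IH _ (sE 0%N) v; split=> -[vn nv]; split=> // /E.
- by split=> H k; apply/(IH k _ (sE k)).
- by split=> -[k H]; exists k; apply/(IH k _ (sE k)).
- by split=> H m; apply/(IH _ (sE 0%N)).
- by split=> -[m H]; exists m; apply/(IH _ (sE 0%N)).
Qed.

Definition truth_bits (x : models phi) : {ptws truth_index -> bool} :=
  fun i => match i with
  | inl j => bit (val x) j
  | inr (p, v) => `[< truth (val x) (subformula p) v >]
  end.

Definition model_space : Type := initial_topology truth_bits.

HB.instance Definition _ := Topological.on model_space.

Let mval (t : model_space) : structure L := val t.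

Lemma model_space_bits : bit_topology (truth_bits : model_space -> _).
Proof. exact: initial_bits. Qed.

Lemma models_invariant : Defs.invariant (@logic_action L) (models phi).
Proof.
move=> g x xM; rewrite /models /=; apply/sat_act.
by move: xM; congr (sat _ _ _); apply: val_inj.
Qed.

Definition model_action (g : Sinf) (t : model_space) : model_space :=
  exist _ (logic_action g (mval t))
    (mem_set (models_invariant g (set_mem (valP t)))).

Definition truth_act_index g (i : truth_index) : truth_index :=
  match i with
  | inl j => inl (act_index g j)
  | inr (p, v) => inr (p, map (g^-1 : Sinf)%g v)
  end.

Lemma truth_bits_act g t i :
  truth_bits (model_action g t) i = truth_bits t (truth_act_index g i).
Proof. by case: i => [j|[p v]] //=; apply: asbool_equiv_eq; exact: truth_act. Qed.

Lemma model_polish_space (R : realType) : polish_space R model_action.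
Proof.
split.
- apply: (@polish_of_bits R _ _ _ model_space_bits coherent).
  + by move=> x y xy; apply/val_inj/bit_inj => i; exact: (xy (inl i)).
  + exact: pi02_coherent.
  + move=> x; split=> [|[p v] /=].
      by apply/asboolP/(truth_tuple _ phi [tuple]); exact: (set_mem (valP x)).
    rewrite asboolE truth_clause (_ : (fun k w => is_true `[< _ >]) =
      fun k w => truth (mval x) (child (subformula p) k) w) //.
    by apply/funext => k; apply/funext => w; rewrite asboolE subformula_rcons.
  + move=> b bP; pose x : structure L := fun i s => b (inl (existT _ i s)).
    have bx i : b (inl i) = bit x i by case: i.
    have bT := coherent_truth bx bP.
    have xM : x \in models phi.
      by apply/mem_set/(truth_tuple x phi [tuple])/(bT [::] [::]); case: bP.
    exists (exist _ x xM) => -[i|[p v]] /=; first by rewrite bx.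
    by apply/asboolP/idP => /(bT p v).
- split=> [t|g h t]; apply: val_inj; have [la1 laM] := logic_action_is_action L.
    exact: la1.
  exact: laM.
- apply: (action_continuous model_space_bits truth_bits_act) => g [i|[p v]].
    by apply: filterS (nbhs_act_index g i) => h /= ->.
  by apply: filterS (nbhs_map_inv g v) => h /= ->.
Qed.

(** The added bits are truth values of formulas, which are already Borel conditions on
    structures. *)
Lemma borel_model_image (P : set model_space) : borel P -> borel (mval @` P).
Proof.
have bM : borel (models phi) by exact: borel_sat.
move: P; apply: (@bits_borel_ind _ _ _ model_space_bits
  [set A | borel (mval @` A)]) => [|i]; first split.
- by rewrite /= image_set0; exact: borel_open open0.
- move=> A bA; rewrite setTD /= (_ : mval @` (~` A) = models phi `\` (mval @` A)).
    by apply: borel_and => //; exact: borel_setC.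
  apply/seteqP; split=> [_ [t nA <-]|x [xM nA]].
    split; first exact: (set_mem (valP t)).
    by move=> [u Au /val_inj ut]; apply: nA; rewrite -ut.
  by exists (exist _ x (mem_set xM)) => // Ax; apply: nA; exists (exist _ x (mem_set xM)).
- by move=> F bF; rewrite /= image_bigcup; exact: borel_bigcup.
pose Q (i : truth_index) x := match i with inl j => bit x j : Prop
  | inr (p, v) => truth x (subformula p) v end.
have tQ t : truth_bits t i <-> Q i (mval t).
  by case: i => [j|[p v]] //=; rewrite asboolE.
rewrite /= (_ : _ @` _ = [set x | models phi x /\ Q i x]).
  apply: borel_and => //; case: i {tQ} => [j|[p v]].
    exact: borel_bit.
  exact: borel_truth.
apply/seteqP; split=> [_ [t /tQ tP <-]|x [xM /= Qx]].
  by split=> //; exact: (set_mem (valP t)).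
by exists (exist _ x (mem_set xM)) => //; exact/tQ.
Qed.

(* Only the Borel form of the conclusion is asked of the Polish space of
   models, as it is implied by both [TVC_II] and [TVC_III]. *)
Lemma models_dichotomy (R : realType) :
  countably_many (same_orbit model_action) [set: model_space] \/
  (exists P, [/\ borel P, ~ countable P &
     pairwise_inequivalent (same_orbit model_action) P]) ->
  countably_many (@isomorphic L) (models phi) \/
  perfectly_many (@isomorphic L) (models phi).
Proof.
have orbitE (t u : model_space) : same_orbit model_action t u <->
    same_orbit (@logic_action L) (mval t) (mval u).
  split=> -[g gt]; exists g; first by rewrite -gt.
  exact: val_inj.
rewrite isomorphicE => -[cM|[P [bP nP iP]]]; [left|right].
  pose f (A : set model_space) := mval @` A.
  apply: (@sub_countableW _ _ (f @`
    [set [set y | same_orbit model_action x y] | x in [set: model_space]])).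
    move=> _ [x xM <-]; pose t : model_space := exist _ x (mem_set xM).
    exists [set u | same_orbit model_action t u]; first by exists t.
    apply/seteqP; split=> [_ [u /orbitE tu <-] //|y [g xy]].
    exists (model_action g t); first by exists g.
    by rewrite -xy.
  exact: sub_countable (card_image_le _ _) cM.
(* A set perfect in the finer topology of models may fail to be closed among structures, so a
   perfect set is extracted from the Borel image. *)
have [|Q [Q0 pQ QP]] := borel_has_perfect (polish_structure R L) (borel_model_image bP).
  by move/(countable_inj_image val_inj).
exists Q; split=> // [x /QP[t _ <-]|]; first exact: (set_mem (valP t)).
move=> x y /QP[t Pt <-] /QP[u Pu <-] tu /orbitE; apply: iP => // tuE.
by apply: tu; rewrite tuE.
Qed.

End Subformulas.

(** * Equivalence of the conjectures *)

Lemma countably_many_preimage (G : groupType) (X Y : Type) (a : G -> X -> X)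
    (b : G -> Y -> Y) (f : X -> Y) (B : set X) :
  injective f -> (forall g x, f (a g x) = b g (f x)) ->
  countably_many (same_orbit b) (f @` B) -> countably_many (same_orbit a) B.
Proof.
move=> fI fa cB; apply: (@sub_countableW _ _ ((fun C => f @^-1` C) @`
    [set [set y | same_orbit b x y] | x in f @` B])).
  move=> _ [x Bx <-]; exists [set y | same_orbit b (f x) y].
    by exists (f x) => //; exists x.
  apply/seteqP; split=> y [g gx]; exists g; first by apply: fI; rewrite fa.
  by rewrite -gx fa.
exact: sub_countable (card_image_le _ _) cB.
Qed.

(** The embedding is only Borel, so pulling back a perfect set of codes gives an uncountable Borel
    set. This is what [TVC_III] asks; in a Polish space [borel_has_perfect] improves it to a perfect
    set. *)
Lemma invariant_dichotomy (R : realType) (X : topologicalType)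
    (a : Sinf -> X -> X) (B : set X) :
  vaught_conjecture -> borel_space R a -> borel B -> Defs.invariant a B ->
  countably_many (same_orbit a) B \/ exists P, [/\ borel P, ~ countable P,
    P `<=` B & pairwise_inequivalent (same_orbit a) P].
Proof.
move=> VC aX bB iB; have [f [bf fI fa] fB] := borel_space_embedding aX.
have ifB : Defs.invariant (@logic_action L_infty) (f @` B).
  by move=> g _ [x Bx <-]; exists (a g x); [exact: iB|exact: fa].
have [phi phiE] := lopez_escobar (fB B bB iB) ifB.
have := VC L_infty phi; rewrite phiE isomorphicE => -[cB|[P [P0 pP PB iP]]].
  by left; exact: countably_many_preimage fI fa cB.
right; exists (f @^-1` P); split.
- exact: bf (borel_closed pP.1).
- move=> cP; apply: (polish_perfect_uncountable (polish_structure R L_infty) P0 pP).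
  (* P consists of codes of points of B, so it is the image of its preimage and would be countable
     along with it. *)
  have -> : P = f @` (f @^-1` P).
    by apply/seteqP; split=> [y Py|_ [x Px <-] //]; have [x _ xy] := PB y Py;
      exists x; rewrite // /preimage /= xy.
  exact: sub_countable (card_image_le _ _) cP.
- by move=> x /= /PB[y By /fI <-].
- move=> x y Px Py xy [g gxy]; apply: (iP (f x) (f y)) => //.
    by move=> /fI.
  by exists g; rewrite -gxy fa.
Qed.

Lemma polish_dichotomy_vaught (R : realType) :
  (forall (X : topologicalType) (a : Sinf -> X -> X), polish_space R a ->
    countably_many (same_orbit a) [set: X] \/
    exists P, [/\ borel P, ~ countable P & pairwise_inequivalent (same_orbit a) P]) ->
  vaught_conjecture.
Proof.
by move=> H L phi; apply: (models_dichotomy R); apply: H; exact: model_polish_space.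
Qed.

Theorem corollary2p2 (R : realType) :
  universal_borel_space R (@logic_action L_infty) /\
  [/\ vaught_conjecture <-> TVC_I R Sinf,
      vaught_conjecture <-> TVC_II R Sinf &
      vaught_conjecture <-> TVC_III R Sinf].
Proof.
have VC_I : vaught_conjecture -> TVC_I R Sinf.
  move=> VC X a aX B bB iB.
  have [|[P [bP nP PB iP]]] := invariant_dichotomy VC (polish_borel_space aX) bB iB.
    by left.
  right; have [pX _ _] := aX; have [Q [Q0 pQ QP]] := borel_has_perfect pX bP nP.
  exists Q; split=> //; first exact: subset_trans PB.
  by move=> x y /QP Px /QP Py; exact: iP.
have I_II : TVC_I R Sinf -> TVC_II R Sinf.
  by move=> TI X a aX; apply: TI => //; exact: borel_open openT.
have II_VC : TVC_II R Sinf -> vaught_conjecture.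
  move=> TII; apply: (@polish_dichotomy_vaught R) => X a aX.
  have [|[P [P0 pP _ iP]]] := TII X a aX; [by left|right].
  exists P; split=> //; first exact: borel_closed pP.1.
  by have [pX _ _] := aX; exact: polish_perfect_uncountable pX P0 pP.
have III_VC : TVC_III R Sinf -> vaught_conjecture.
  move=> TIII; apply: (@polish_dichotomy_vaught R) => X a aX.
  by apply: TIII; exact: polish_borel_space.
have VC_III : vaught_conjecture -> TVC_III R Sinf.
  move=> VC X a aX.
  have [||[P [bP nP _ iP]]] := invariant_dichotomy VC aX (borel_open openT) => //.
    by left.
  by right; exists P.
split; last first.
  by split; split=> // H; [apply: II_VC; exact: I_II|apply: I_II; exact: VC_I].
split; first exact: polish_borel_space (logic_polish_space R L_infty).
by move=> X a aX; have [f fE _] := borel_space_embedding aX; exists f.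
Qed.
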